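(* Given a positive integer $n$ and a finite subset $I\subset\mathbf{R}_{\geq 0}$, there is a positive integer $\ell$ (depending on $n$ and $I$) such that for every monomial $\mathbf{R}$-ideal $\mathfrak{a}$ on $\mathbf{A}^n$ with exponents in $I$, there is a divisor $E$ over $\mathbf{A}^n$ that computes $\mathrm{mld}_0(\mathbf{A}^n,\mathfrak{a})$ and such that $k_E\leq\ell$.
   Context: We work over an algebraically closed field $k$ of characteristic $0$; $\mathbf{A}^n=\mathrm{Spec}\,k[x_1,\ldots,x_n]$ and $0$ is the origin. Varieties are reduced and irreducible. A divisor over a variety $X$ is a prime divisor $E$ on a normal variety $Y$ that is proper and birational over $X$; two such divisors are identified if they give the same valuation $\mathrm{ord}_E$ of the function field. The center $c_X(E)$ is the image of $E$ in $X$. For a nonzero coherent ideal $\mathfrak{b}\subseteq\mathcal{O}_X$, $\mathrm{ord}_E(\mathfrak{b})$ is the integer $e\ge 0$ with $\mathfrak{b}\cdot\mathcal{O}_{Y,E}=(t^e)$, $t$ a uniformizer of the DVR $\mathcal{O}_{Y,E}$. An $\mathbf{R}$-ideal on $X$ is a formal product $\mathfrak{a}=\prod_{j=1}^r\mathfrak{a}_j^{\lambda_j}$ with $\mathfrak{a}_j$ nonzero coherent ideals in $\mathcal{O}_X$ and $\lambda_j\in\mathbf{R}_{\geq 0}$; it has exponents in $I$ if $\lambda_j\in I$ for all $j$. An $\mathbf{R}$-ideal on $\mathbf{A}^n$ is monomial if it is of this form with each $\mathfrak{a}_j$ generated by monomials in $x_1,\ldots,x_n$. Put $\mathrm{ord}_E(\mathfrak{a})=\sum_j\lambda_j\,\mathrm{ord}_E(\mathfrak{a}_j)$.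 For $X$ normal with $K_X$ $\mathbf{Q}$-Cartier, $k_E$ is the coefficient of $E$ in the discrepancy divisor $K_{Y/X}$, and the log discrepancy is $a_E(X,\mathfrak{a})=k_E+1-\mathrm{ord}_E(\mathfrak{a})$. The minimal log discrepancy at a closed point $x\in X$ is $\mathrm{mld}_x(X,\mathfrak{a})=\inf\{a_E(X,\mathfrak{a})\mid E \text{ a divisor over } X,\ c_X(E)=x\}$. If $\mathrm{mld}_x(X,\mathfrak{a})\ge 0$, a divisor $E$ over $X$ computes $\mathrm{mld}_x(X,\mathfrak{a})$ if $c_X(E)=x$ and $a_E(X,\mathfrak{a})=\mathrm{mld}_x(X,\mathfrak{a})$. If $\mathrm{mld}_x(X,\mathfrak{a})<0$, $E$ computes $\mathrm{mld}_x(X,\mathfrak{a})$ if $c_X(E)=x$ and $a_E(X,\mathfrak{a})<0$. *)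

(* Defs.v *)
(* Varieties Y with a proper birational morphism Y -> A^n are encoded as in
   Zariski and Chevalley (EGA I, section 8): the function field of Y is
   identified with K = k(x_1, ..., x_n), and Y with the set of its local rings
   O_{Y,y} (y a scheme point), which are subrings of K. *)
From HB Require Import structures.
From mathcomp Require Import all_boot all_order all_algebra.
From mathcomp Require Import mpoly.
From mathcomp Require Import boolp classical_sets cardinality.
From mathcomp Require Import reals constructive_ereal ereal.

Set Implicit Arguments.
Unset Strict Implicit.
Unset Printing Implicit Defensive.

Import Order.TTheory GRing.Theory Num.Theory.
Local Open Scope classical_set_scope.
Local Open Scope ring_scope.

Section Subrings.
Variable L : comNzRingType.
Implicit Types A I J S P : set L.

Definition is_subring A : Prop :=
  [/\ A 1, forall x y, A x -> A y -> A (x - y)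
    & forall x y, A x -> A y -> A (x * y)].

Definition is_submodule A J : Prop :=
  [/\ J 0, forall x y, J x -> J y -> J (x + y)
    & forall a x, A a -> J x -> J (a * x)].

(* S need not be contained in A. *)
Definition submodule_gen A S : set L := smallest (is_submodule A) S.

Definition is_ideal A J : Prop := J `<=` A /\ is_submodule A J.

Definition prime_ideal A P : Prop :=
  [/\ is_ideal A P, ~ P 1
    & forall x y, A x -> A y -> P (x * y) -> P x \/ P y].

End Subrings.

Section Subfields.
Variable K : fieldType.
Implicit Types A O V P : set K.

Definition localization A P : set K :=
  [set z | exists a s, [/\ A a, A s, ~ P s & z = a / s]].

(* The local rings of Spec A, when K is the fraction field of A. *)
Definition affine_points A : set (set K) := localization A @` prime_ideal A.

(* The maximal ideal, when O is local. *)
Definition nonunits O : set K := [set z | O z /\ (z = 0 \/ ~ O z^-1)].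

Definition valuation_ring V : Prop :=
  is_subring V /\ forall z, V z \/ V z^-1.

Definition dominates V O : Prop := O `<=` V /\ nonunits O `<=` nonunits V.

Definition integrally_closed O : Prop :=
  forall (z : K) (p : {poly K}),
    p \is monic -> (forall i, O p`_i) -> root p z -> O z.

(* For a local domain O. *)
Definition dim_one O : Prop :=
  nonunits O <> [set 0] /\
  forall P, prime_ideal O P -> P <> [set 0] -> P = nonunits O.

End Subfields.

Section AffineSpace.
Variables (k : closedFieldType) (n : nat).

Definition funfield : fieldType := {fraction {mpoly k[n]}}.

Local Notation K := funfield.

Definition regular (f : {mpoly k[n]}) : K := tofrac f.

Definition coord (j : 'I_n) : K := regular 'X_j.

(* The k[x]-subalgebra of K generated by s. *)
Definition chart (s : seq K) : set K :=
  smallest (@is_subring K) (range regular `|` [set` s]).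

(* Y is glued from finitely many affine charts of finite type over A^n. *)
Definition finite_type (Y : set (set K)) : Prop :=
  exists ss : seq (seq K),
    Y = [set O | exists2 s, s \in ss & affine_points (chart s) O].

(* Valuative criteria; as Y is integral with function field K, it is enough to
   test them on valuation rings of K. *)
Definition separated (Y : set (set K)) : Prop :=
  forall V O1 O2, valuation_ring V -> Y O1 -> Y O2 ->
    dominates V O1 -> dominates V O2 -> O1 = O2.

Definition universally_closed (Y : set (set K)) : Prop :=
  forall V, valuation_ring V -> range regular `<=` V ->
    exists2 O, Y O & dominates V O.

Definition normal (Y : set (set K)) : Prop :=
  forall O, Y O -> integrally_closed O.

Definition normal_proper_birational (Y : set (set K)) : Prop :=
  [/\ finite_type Y, separated Y, universally_closed Y & normal Y].

Definition uniformizer (O : set K) (t : K) : Prop :=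
  nonunits O = [set t * z | z in O].

Definition derivation (D : K -> K) : Prop :=
  [/\ forall c : k, D (regular c%:MP) = 0,
      forall x y, D (x + y) = D x + D y
    & forall x y, D (x * y) = D x * y + x * D y].

(* The D i, restricted to O, are k-derivations of O dual to the y i.  For O the
   local ring of a smooth codimension one point of an n-dimensional k-variety,
   Omega_{O/k} is free of rank n, so this says that dy_1, ..., dy_n is a basis
   of it, with dual basis D_1, ..., D_n. *)
Definition local_coordinates (O : set K) (y : 'I_n -> K) (D : 'I_n -> K -> K) :
    Prop :=
  [/\ forall i, O (y i),
      forall i, derivation (D i),
      forall i z, O z -> O (D i z)
    & forall i j, D i (y j) = (i == j)%:R].

(* A prime divisor E on a normal variety Y proper and birational over A^n is a
   codimension one point of Y, given by the local ring O_{Y,E}.  The record also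
   carries a choice of a uniformizer and of local coordinates at the generic
   point of E; such choices always exist when k has characteristic 0 (Y is
   regular in codimension one, and smooth at its regular points), and ord_E and
   k_E below do not depend on them. *)
Record divisor_over := DivisorOver {
  div_model : set (set K);
  div_modelP : normal_proper_birational div_model;
  div_ring : set K;
  div_ringP : div_model div_ring;
  div_codim1 : dim_one div_ring;
  div_unif : K;
  div_unifP : uniformizer div_ring div_unif;
  div_coord : 'I_n -> K;
  div_deriv : 'I_n -> K -> K;
  div_coordP : local_coordinates div_ring div_coord div_deriv }.

Implicit Types (E : divisor_over) (b : set {mpoly k[n]}).

(* The e with b . O_{Y,E} = (t^e), where b is a subset of the function field. *)
Definition ordK E (b : set K) : nat :=
  xget 0%N [set e | submodule_gen (div_ring E) b
                    = [set div_unif E ^+ e * z | z in div_ring E]].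

Definition ord E b : nat := ordK E (regular @` b).

(* dx_1 /\ ... /\ dx_n = jacobian E * (dy_1 /\ ... /\ dy_n) *)
Definition jacobian E : K :=
  \det (\matrix_(i < n, j < n) div_deriv E i (coord j)).

(* As K_{A^n} = div(dx_1 /\ ... /\ dx_n) = 0, the divisor K_{Y/A^n} is the
   divisor on Y of the pulled back form dx_1 /\ ... /\ dx_n. *)
Definition k_ E : nat := ordK E [set jacobian E].

(* The point of A^n = Spec k[x] which is the image of the generic point of E;
   the center of E is its closure. *)
Definition center E : set {mpoly k[n]} :=
  [set f | nonunits (div_ring E) (regular f)].

(* The closed point x of Spec k[x]. *)
Definition closed_point (x : 'I_n -> k) : set {mpoly k[n]} :=
  [set f | f.@[x] = 0].

Definition origin : 'I_n -> k := fun=> 0.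

Variable R : realType.

Record Rideal := RIdeal {
  nfactors : nat;
  factor : 'I_nfactors -> set {mpoly k[n]};
  exponent : 'I_nfactors -> R;
  factor_ideal : forall j, is_ideal setT (factor j);
  factor_neq0 : forall j, factor j <> [set 0];
  exponent_ge0 : forall j, 0 <= exponent j }.

Implicit Type a : Rideal.

Definition exponents_in (I : set R) a : Prop := forall j, I (@exponent a j).

Definition monomial a : Prop :=
  forall j, exists M : set 'X_{1..n},
    @factor a j = submodule_gen setT [set 'X_[k, m] | m in M].

Definition ordR E a : R :=
  \sum_(j < nfactors a) exponent j * (ord E (@factor a j))%:R.

Definition log_discrepancy E a : R := (k_ E)%:R + 1 - ordR E a.

Definition mld (x : 'I_n -> k) a : \bar R :=
  ereal_inf [set (log_discrepancy E a)%:E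
            | E in [set E | center E = closed_point x]].

Definition computes_mld E (x : 'I_n -> k) a : Prop :=
  center E = closed_point x /\
  if (0%:E <= mld x a)%E then (log_discrepancy E a)%:E = mld x a
  else log_discrepancy E a < 0.

End AffineSpace.

(* Main.v *)
(* For E centered at 0 with w_i = ord_E(x_i), writing x_i = t^{w_i} u_i shows
   that dx_1 /\ ... /\ dx_n vanishes along E to order at least |w| - 1; hence
   a_E(a) >= phi(w) := |w| - sum_j lambda_j min_{x^m in a_j} <m, w>.  Equality
   holds for the exceptional divisor of the weighted blowup of weight w, for w
   primitive, so it is enough to bound |w| for some positive integral w at which
   phi is minimal or negative.  If there were no such bound, a sequence of worse
   and worse counterexamples would have a limit along an ultrafilter; the limit
   is again monomial, phi >= 0 for it, and its phi attains its minimum, by two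
   applications of Dickson's lemma.  As the limit ideals are finitely generated,
   they are contained in the ideals of some counterexample, which then has the
   same minimizer. *)
From HB Require Import structures.
Require Import Defs.
From mathcomp Require Import all_boot all_order all_algebra.
From mathcomp Require Import mpoly generic_quotient.
From mathcomp Require Import boolp classical_sets cardinality filter.
From mathcomp Require Import reals constructive_ereal ereal.
From mathcomp Require Import zify ring lra.

Set Implicit Arguments.
Unset Strict Implicit.
Unset Printing Implicit Defensive.

Import Order.TTheory GRing.Theory Num.Theory.
Local Open Scope classical_set_scope.
Local Open Scope ring_scope.

(** * Monomial ideals and weights *)

(** The number of factors of an ideal is not bounded, so factors with the same exponent are
    multiplied together: an ideal becomes a family of order functions indexed by a fixed finite
    type, the positive elements of I. Positivity matters: phi >= 0 at w then bounds each order at w,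
    so the orders at a given w take finitely many values along the counterexamples and have a limit.
    Attainment of the minimum is not automatic, because with real exponents the values of phi need
    not be discrete. Passing to a primitive weight costs nothing, since phi is homogeneous. The
    divisor must come with a normal proper model. Each chart ring of the weighted blowup is taken as
    the intersection of the ring of the monomial valuation with k[x][1/x_i]; both are normal, so the
    work lies in finite generation and in the valuative criteria. Characteristic 0 enters through
    the derivations dual to monomial coordinates, whose formula divides by a weight. *)

Lemma dickson (A : eqType) (cs : seq (A -> nat)) (M : set A) :
  exists F : seq A, (forall f, f \in F -> M f) /\
    forall a, M a -> exists2 f, f \in F & all (fun c => c f <= c a)%N cs.
Proof.
elim: cs M => [|c cs IH] M.
  have [[a Ma]|M0] := pselect (exists a, M a).
    exists [:: a]; split=> [f|b _]; first by rewrite inE => /eqP->.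
    by exists a => //; rewrite inE.
  by exists [::]; split=> // a Ma; case: M0; exists a.
have [F [FM Fmin]] := IH M.
(* An element with value of c at least N is dominated by the basis F for the other functions. The
   values of c below N are finitely many, and each slice has a basis of its own. *)
pose N := (\max_(f <- F) c f)%N.
have [G GP] := choice (fun v => IH [set a | M a /\ c a = v]).
exists (F ++ flatten [seq G v | v <- iota 0 N]); split.
  move=> f; rewrite mem_cat => /orP[/FM//|/flattenP[s /mapP[v _ ->] fs]].
  by case: (GP v) => /(_ f fs)[].
move=> a Ma; case: (leqP N (c a)) => [Na|aN].
  have [f fF cf] := Fmin a Ma; exists f; first by rewrite mem_cat fF.
  by rewrite /= cf andbT (leq_trans _ Na)// /N (big_rem f fF) leq_maxl.
have [GM /(_ a (conj Ma erefl))[f fG cf]] := GP (c a).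
exists f; last by rewrite /= cf andbT; case: (GM f fG) => _ ->.
rewrite mem_cat; apply/orP; right; apply/flattenP; exists (G (c a)) => //.
by apply: map_f; rewrite mem_iota.
Qed.

Lemma seq_min (R : realDomainType) (A : eqType) (F : A -> R) (s : seq A) x :
  x \in s -> exists2 y, y \in s & forall z, z \in s -> F y <= F z.
Proof.
elim: s x => [//|a s IH] x _; case: s IH => [_|b s /(_ b)].
  by exists a; rewrite ?inE// => z; rewrite inE => /eqP->.
rewrite mem_head => /(_ isT)[y ys ymin].
have [ya|ay] := leP (F y) (F a).
  exists y; first by rewrite inE ys orbT.
  by move=> z; rewrite inE => /predU1P[->//|/ymin].
exists a; first by rewrite mem_head.
move=> z; rewrite inE => /predU1P[->//|/ymin]; exact/le_trans/ltW.
Qed.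

Lemma all_flatten (A : Type) (p : pred A) (s : seq (seq A)) :
  all p (flatten s) = all (all p) s.
Proof. by elim: s => //= x s <-; rewrite all_cat. Qed.

Section Weights.
Variable n : nat.
Implicit Types m w : 'X_{1..n}.

Definition dot m w : nat := (\sum_(i < n) m i * w i)%N.

Definition wpos w : Prop := forall i, (0 < w i)%N.

Lemma dotC m w : dot m w = dot w m.
Proof. by apply: eq_bigr => i _; rewrite mulnC. Qed.

Lemma dotDl m1 m2 w : dot (m1 + m2)%MM w = (dot m1 w + dot m2 w)%N.
Proof. by rewrite -big_split; apply: eq_bigr => i _; rewrite mnmDE mulnDl. Qed.

Lemma dotDr m w1 w2 : dot m (w1 + w2)%MM = (dot m w1 + dot m w2)%N.
Proof. by rewrite dotC dotDl !(dotC m). Qed.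

Lemma dotMl m w k : dot (m *+ k)%MM w = (dot m w * k)%N.
Proof.
by rewrite big_distrl; apply: eq_bigr => i _; rewrite mulmnE mulnAC.
Qed.

Lemma dotMr m w k : dot m (w *+ k)%MM = (dot m w * k)%N.
Proof. by rewrite dotC dotMl dotC. Qed.

Lemma dot0 w : dot 0%MM w = 0%N.
Proof. by apply: big1 => i _; rewrite mnm0E. Qed.

Lemma dot1 i w : dot U_(i)%MM w = w i.
Proof.
rewrite /dot (bigD1 i)//= mnm1E eqxx mul1n big1 ?addn0// => j ji.
by rewrite mnm1E eq_sym (negPf ji).
Qed.

Lemma leq_mdeg_dot m w : wpos w -> (mdeg m <= dot m w)%N.
Proof. by move=> w0; rewrite mdegE leq_sum// => i _; rewrite leq_pmulr. Qed.

(* The functions [w |-> ord_w(a)] for a product a of monomial ideals. *)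
Definition order_fun (H : 'X_{1..n} -> nat) : Prop :=
  forall w, wpos w ->
    exists m, dot m w = H w /\ forall w', wpos w' -> (H w' <= dot m w')%N.

Lemma order_fun_sum (T : finType) (P : pred T) (H : T -> 'X_{1..n} -> nat) :
  (forall j, order_fun (H j)) -> order_fun (fun w => \sum_(j | P j) H j w)%N.
Proof.
move=> HP w w0; have [m mP] := choice (fun j => HP j w w0).
have dotE w' : dot (\sum_(j | P j) m j)%MM w' = (\sum_(j | P j) dot (m j) w')%N.
  by apply: (big_morph (fun m => dot m w')) => [x y|]; rewrite ?dotDl ?dot0.
exists (\sum_(j | P j) m j)%MM; rewrite dotE; split.
  by apply: eq_bigr => j _; case: (mP j).
by move=> w' w'0; rewrite dotE leq_sum// => j _; case: (mP j) => _; apply.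
Qed.

Section LogDiscrepancy.
Variables (R : realType) (T : finType) (lam : T -> R).
Hypothesis lam_gt0 : forall r, 0 < lam r.
Implicit Type H : T -> 'X_{1..n} -> nat.

(* The log discrepancy of the monomial valuation of weight w, see [ordR_phi]. *)
Definition phi H w : R := (mdeg w)%:R - \sum_r lam r * (H r w)%:R.

(* If [w0 <= w] for the coordinates chosen below, then phi is affine on the ray
   from w0 through w, so it cannot decrease from w0 to w. *)
Lemma phi_min_attained (F : T -> seq 'X_{1..n}) H :
  (forall w, wpos w -> forall r, (forall f, f \in F r -> H r w <= dot f w)%N) ->
  (forall w, wpos w -> forall r, exists2 f, f \in F r & dot f w = H r w) ->
  (forall w, wpos w -> 0 <= phi H w) ->
  exists2 w0, wpos w0 & forall w, wpos w -> phi H w0 <= phi H w.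
Proof.
move=> Hle Hex phi_ge0.
(* Three kinds of functions are compared: the coordinates, the slacks dot f w - H r w of the
   generators, and the indicators of zero slack. So from w0 to w no slack decreases, and generators
   that are minimal at w0 stay minimal at w. *)
pose cs : seq ('X_{1..n} -> nat) :=
  [seq (fun w => w i) | i <- enum 'I_n] ++
  flatten [seq [seq (fun w => dot f w - H r w)%N | f <- F r] | r <- enum T] ++
  flatten [seq [seq (fun w => dot f w == H r w : nat) | f <- F r]
          | r <- enum T].
have [G [Gpos Gmin]] := dickson cs [set w | wpos w].
have below w : wpos w -> exists2 w0, w0 \in G & phi H w0 <= phi H w.
  move=> w_pos; have [w0 w0G] := Gmin w w_pos.
  rewrite !all_cat !all_flatten => /and3P[c1 c2 c3].
  have le_w i : (w0 i <= w i)%N.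
    by move: c1; rewrite all_map => /allP/(_ i); apply; rewrite mem_enum.
  have {}c2 r f : f \in F r -> (dot f w0 - H r w0 <= dot f w - H r w)%N.
    move=> fF; move: c2; rewrite all_map => /allP/(_ r).
    rewrite mem_enum => /(_ isT); rewrite /= all_map => /allP; exact.
  have {}c3 r f : f \in F r -> dot f w0 = H r w0 -> dot f w = H r w.
    move=> fF fE; move: c3; rewrite all_map => /allP/(_ r).
    rewrite mem_enum => /(_ isT); rewrite /= all_map => /allP/(_ f fF)/=.
    by rewrite fE eqxx; case: eqP.
  have w0_pos : wpos w0 by exact: Gpos.
  exists w0 => //; rewrite leNgt; apply/negP => lt_phi.
  pose d := (w - w0)%MM.
  have wE : w = (w0 + d)%MM by rewrite addmC submK//; apply/mnm_lepP.
  have /choice[f0 f0P] : forall r, exists f, f \in F r /\ dot f w0 = H r w0.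
    by move=> r; have [f] := Hex w0 w0_pos r; exists f.
  have wk_pos k : wpos (w0 + d *+ k)%MM.
    by move=> i; rewrite mnmDE addn_gt0 w0_pos.
  (* [f0 r] is minimal at w0 and at w, and no slack decreases in between, so [f0 r] grows along d at
     most as fast as any other generator. Hence it stays minimal on the whole ray. *)
  have HE k r : H r (w0 + d *+ k)%MM = dot (f0 r) (w0 + d *+ k)%MM.
    have [f0F f0E] := f0P r.
    have [f fF fE] := Hex _ (wk_pos k) r.
    apply/eqP; rewrite eqn_leq Hle//= -fE !dotDr !dotMr.
    have := c2 r f fF; have := c3 r _ f0F f0E; have := Hle _ w0_pos r f fF.
    have := Hle _ w_pos r f fF.
    rewrite -f0E wE !dotDr => h1 h2 h3 h4.
    have : (dot (f0 r) d <= dot f d)%N by lia.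
    by move=> h5; rewrite leq_add// leq_mul2r h5 orbT.
  have H0 r : (H r w0)%:R = (dot (f0 r) w0)%:R :> R by case: (f0P r) => _ ->.
  have H1 r : (H r w)%:R = (dot (f0 r) w0)%:R + (dot (f0 r) d)%:R :> R.
    by rewrite wE -[d]mulm1n HE dotDr natrD.
  have phiE k : phi H (w0 + d *+ k)%MM = phi H w0 + k%:R * (phi H w - phi H w0).
    have -> : phi H w - phi H w0
        = (mdeg d)%:R - \sum_r lam r * (dot (f0 r) d)%:R.
      rewrite /phi {1}wE mdegD natrD opprB addrA.
      under eq_bigr do rewrite H1 mulrDr.
      under [\sum_r lam r * (H r w0)%:R]eq_bigr do rewrite H0.
      by rewrite big_split /=; ring.
    rewrite /phi mdegD mdegMn natrD natrM.
    under eq_bigr do rewrite HE dotDr dotMr natrD natrM mulrDr mulrA.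
    under [\sum_r lam r * (H r w0)%:R]eq_bigr do rewrite H0.
    by rewrite big_split /= -mulr_suml; ring.
  (* The affine function k |-> phi (w0 + k d) vanishes at k = q, and any integer beyond q makes it
     negative. *)
  set q := phi H w0 / (phi H w0 - phi H w).
  have den : 0 < phi H w0 - phi H w by rewrite subr_gt0.
  have q_ge0 : 0 <= q by rewrite divr_ge0 ?(ltW den)// phi_ge0.
  have := phi_ge0 _ (wk_pos (Num.bound q)); rewrite phiE leNgt => /negP; apply.
  have := archi_boundP q_ge0; rewrite /q ltr_pdivrMr// => ltq; lra.
(* Any positive weight shows that G is nonempty. *)
pose one : 'X_{1..n} := [multinom 1%N | i < n].
have one_pos : wpos one by move=> i; rewrite mnmE.
have [w1 w1G _] := below one one_pos.
have [w0 w0G w0min] := seq_min (phi H) w1G.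
exists w0; first exact: Gpos.
move=> w /below[w2 w2G]; apply: le_trans; exact: w0min.
Qed.

(** If no piece belonged to U, all the complements would, hence also their finite intersection,
    which misses the union. *)
Lemma ultra_finite (S : Type) (X : finType) (U : set_system S)
    (P : X -> set S) : UltraFilter U ->
  U (fun s => exists x, P x s) -> exists x, U (P x).
Proof.
move=> UU Uex; apply: contrapT => noU.
have UC x : U (~` P x).
  by have [|//] := in_ultra_setVsetC (P x) UU => UP; case: noU; exists x.
have : U (fun s => forall x, (~` P x) s) by exact: filter_forall.
move/(filterI Uex) => /filter_ex[s [[x Px] /(_ x)]]; exact.
Qed.

(* If no bound existed, a limit of worse and worse counterexamples along an
   ultrafilter would again be given by monomial ideals; these are finitely
   generated, so they contradict some of the counterexamples. *)
Lemma bounded_phi_min :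
  exists l : nat, forall H, (forall r, order_fun (H r)) ->
    exists w, [/\ wpos w, (mdeg w <= l)%N &
      phi H w < 0 \/ forall w', wpos w' -> phi H w <= phi H w'].
Proof.
apply: contrapT => /forallNP noL.
have /choice[H HP] : forall l, exists H, (forall r, order_fun (H r)) /\
    forall w, wpos w -> (mdeg w <= l)%N -> 0 <= phi H w /\
      exists2 w', wpos w' & phi H w' < phi H w.
  move=> l; have /existsNP[H /not_implyP[HO noW]] := noL l; exists H; split=> //.
  move=> w w_pos wl; apply: contrapT => bad; apply: noW; exists w; split=> //.
  have [phi0|phi0] := ltP (phi H w) 0; [by left|right=> w' w'_pos].
  by rewrite leNgt; apply/negP => lt_phi; apply: bad; split=> //; exists w'.
have [U [UU Uinf]] := ultraFilterLemma eventually_filter.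
have Ugt l : U (fun k => l <= k)%N by apply: Uinf; exists l.
pose memM l r m := forall w, wpos w -> (H l r w <= dot m w)%N.
(* [memM l r] is membership in the integrally closed monomial ideal with order function [H l r]; the
   limit ideal consists of the exponents that belong to it for U-almost all l. *)
pose M r : set 'X_{1..n} := [set m | U (fun l => memM l r m)].
have /choice[F FP] : forall r, exists F : seq 'X_{1..n},
    (forall f, f \in F -> M r f) /\
    forall m, M r m -> exists2 f, f \in F & forall i, (f i <= m i)%N.
  move=> r; have [F [FM Fmin]] :=
    dickson [seq (fun m : 'X_{1..n} => m i) | i <- enum 'I_n] (M r).
  exists F; split=> // m /Fmin[f fF]; rewrite all_map => /allP fm.
  by exists f => // i; apply: (fm i); rewrite mem_enum.
have limM w r : wpos w -> exists2 m, M r m & U (fun l => dot m w = H l r w).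
  (* For l >= mdeg w, phi (H l) w >= 0 gives lam r * H l r w <= mdeg w. A monomial computing H l r w
     has degree at most its weight, so it lies in a finite set independent of l, and U singles out
     one element. *)
  move=> w_pos; pose C := Num.bound ((mdeg w)%:R / lam r).
  have [x] : exists x : 'X_{1..n < C},
      U (fun l => memM l r x /\ dot x w = H l r w).
    apply: ultra_finite; apply: filterS (Ugt (mdeg w)) => l wl.
    have [HO /(_ w w_pos wl)[phi_ge0 _]] := HP l.
    have [m [mE mM]] := HO r w w_pos.
    suff mC : (mdeg m < C)%N by exists (BMultinom mC).
    apply: leq_ltn_trans (leq_mdeg_dot m w_pos) _; rewrite mE -(ltr_nat R).
    have le_q : (H l r w)%:R <= (mdeg w)%:R / lam r.
      rewrite ler_pdivlMr// mulrC.
      move: phi_ge0; rewrite /phi subr_ge0; apply: le_trans.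
      rewrite (bigD1 r)//= lerDl sumr_ge0// => i _.
      by rewrite mulr_ge0// ltW.
    by apply: le_lt_trans le_q _; rewrite archi_boundP// divr_ge0// ltW.
  by move=> Ux; exists (bmnm x); apply: filterS Ux => l [].
have /choice[h hP] : forall wr, exists v : nat, wpos wr.1 ->
    U (fun l => H l wr.2 wr.1 = v).
  move=> [w r]; have [w_pos|] := pselect (wpos w); last by exists 0%N.
  have [m _ Um] := limM w r w_pos; exists (dot m w) => _.
  by apply: filterS Um => l ->.
pose H0 r w := h (w, r).
have UH0 w r : wpos w -> U (fun l => H l r w = H0 r w) by move=> /(hP (w, r)).
have H0le w : wpos w -> forall r f, f \in F r -> (H0 r w <= dot f w)%N.
  move=> w_pos r f fF; have [/(_ f fF) Mf _] := FP r.
  have [l [<- /(_ w w_pos)//]] := filter_ex (filterI (UH0 w r w_pos) Mf).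
have H0ex w : wpos w -> forall r, exists2 f, f \in F r & dot f w = H0 r w.
  move=> w_pos r; have [m Mm Um] := limM w r w_pos.
  have [_ /(_ m Mm)[f fF fm]] := FP r; exists f => //.
  have [l [<- Hl]] := filter_ex (filterI (UH0 w r w_pos) Um).
  apply/eqP; rewrite eqn_leq -{1}Hl leq_sum; last first.
    by move=> i _; rewrite leq_mul2r fm orbT.
  have [/(_ f fF) Mf _] := FP r.
  have [l' [E1 [E2 /(_ w w_pos)]]] := filter_ex
    (filterI (UH0 w r w_pos) (filterI Um Mf)).
  by rewrite -Hl E2.
have UphiE w : wpos w -> U (fun l => phi (H l) w = phi H0 w).
  move=> w_pos.
  have : U (fun l => forall r, H l r w = H0 r w).
    by apply: filter_forall => r; exact: UH0.
  apply: filterS => l E; rewrite /phi; congr (_ - _).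
  by apply: eq_bigr => r _; rewrite E.
have phi0 w : wpos w -> 0 <= phi H0 w.
  move=> w_pos; have [l [<- wl]] :=
    filter_ex (filterI (UphiE w w_pos) (Ugt (mdeg w))).
  by have [_ /(_ w w_pos wl)[]] := HP l.
have [w0 w0_pos w0min] := phi_min_attained H0le H0ex phi0.
have UF : U (fun l => forall r, forall f, f \in F r -> memM l r f).
  apply: filter_forall => r; have [FM _] := FP r.
  elim: (F r) FM => [|f s IH] FM; first exact: nearW.
  have Uf := FM f (mem_head f s).
  have Us : U (fun l => forall f, f \in s -> memM l r f).
    by apply: IH => g gs; apply: FM; rewrite inE gs orbT.
  apply: filterS2 Uf Us => l fl sl g; rewrite inE => /predU1P[->//|]; exact: sl.
(* At such an l all generators of the limit lie in the l-th ideals, so H l <= H0 and phi (H l) >=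
   phi H0, with equality at w0. Thus w0, of degree at most l, minimizes phi (H l), contrary to the
   choice of H l. *)
have [l [[Fl El] wl]] := filter_ex
  (filterI (filterI UF (UphiE w0 w0_pos)) (Ugt (mdeg w0))).
have [_ /(_ w0 w0_pos wl)[_ [w' w'_pos]]] := HP l.
rewrite El ltNge => /negP; apply; apply: le_trans (w0min w' w'_pos) _.
rewrite /phi lerD2l lerN2 ler_sum// => r _; rewrite ler_pM2l// ler_nat.
have [f fF <-] := H0ex w' w'_pos r; exact: Fl.
Qed.

End LogDiscrepancy.
End Weights.

(** * Local rings and discrete valuations in the function field *)

Section Subring.
Variables (L : comNzRingType) (A : set L).
Hypothesis Asub : is_subring A.

Lemma subring1 : A 1. Proof. by case: Asub. Qed.

Lemma subringB x y : A x -> A y -> A (x - y).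
Proof. case: Asub => _ + _; exact. Qed.

Lemma subringM x y : A x -> A y -> A (x * y).
Proof. case: Asub => _ _; exact. Qed.

Lemma subring0 : A 0.
Proof. by rewrite -(subrr 1); exact: subringB subring1 subring1. Qed.

Lemma subringN x : A x -> A (- x).
Proof. by rewrite -[- x]sub0r; apply: subringB; exact: subring0. Qed.

Lemma subringD x y : A x -> A y -> A (x + y).
Proof.
by move=> Ax Ay; rewrite -[y]opprK; apply: subringB => //; exact: subringN.
Qed.

Lemma subring_sum (I : Type) (r : seq I) (P : pred I) (F : I -> L) :
  (forall i, P i -> A (F i)) -> A (\sum_(i <- r | P i) F i).
Proof. by apply: (big_ind A); [exact: subring0|exact: subringD]. Qed.

Lemma subring_prod (I : Type) (r : seq I) (P : pred I) (F : I -> L) :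
  (forall i, P i -> A (F i)) -> A (\prod_(i <- r | P i) F i).
Proof. by apply: (big_ind A); [exact: subring1|exact: subringM]. Qed.

Lemma subringX x e : A x -> A (x ^+ e).
Proof.
move=> Ax; elim: e => [|e IH]; first exact: subring1.
by rewrite exprS; exact: subringM.
Qed.

Lemma subringMn x e : A x -> A (x *+ e).
Proof.
move=> Ax; elim: e => [|e IH]; first exact: subring0.
by rewrite mulrS; exact: subringD.
Qed.

Lemma subring_sign b : A ((-1) ^+ b).
Proof. by apply: subringX; apply: subringN; exact: subring1. Qed.

Lemma subring_det m (M : 'M[L]_m) : (forall i j, A (M i j)) -> A (\det M).
Proof.
move=> AM; apply: subring_sum => s _; apply: subringM; first exact: subring_sign.
exact: subring_prod.
Qed.

End Subring.

Section Localization.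
Variables (K : fieldType) (A P : set K).
Hypotheses (Asub : is_subring A) (Pprime : prime_ideal A P).
Let O := localization A P.

Let P0 : P 0. Proof. by case: Pprime => -[_ []]. Qed.
Let PD x y : P x -> P y -> P (x + y).
Proof. case: Pprime => -[_ [_ + _]] _ _; exact. Qed.
Let PM a x : A a -> P x -> P (a * x).
Proof. case: Pprime => -[_ [_ _ +]] _ _; exact. Qed.
Let PA x : P x -> A x.
Proof. case: Pprime => -[+ _] _ _; exact. Qed.
Let P1 : ~ P 1. Proof. by case: Pprime. Qed.
Let Pmul x y : A x -> A y -> P (x * y) -> P x \/ P y.
Proof. by case: Pprime => _ _; apply. Qed.

Let nP_neq0 s : ~ P s -> s != 0.
Proof. by move=> Ps; apply/eqP => s0; apply: Ps; rewrite s0. Qed.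

Let nPM s u : A s -> A u -> ~ P s -> ~ P u -> ~ P (s * u).
Proof. by move=> As Au Ps Pu /Pmul[]. Qed.

Lemma sub_localization : A `<=` O.
Proof.
move=> a Aa; exists a, 1; split=> //; first exact: subring1.
by rewrite divr1.
Qed.

Lemma localization_subring : is_subring O.
Proof.
split.
- by apply: sub_localization; exact: subring1.
- move=> _ _ [a [s [Aa As Ps ->]]] [b [u [Ab Au Pu ->]]].
  exists (a * u - b * s), (s * u); split.
  + by apply: subringB => //; exact: subringM.
  + exact: subringM.
  + exact: nPM.
  + by field; rewrite !nP_neq0.
- move=> _ _ [a [s [Aa As Ps ->]]] [b [u [Ab Au Pu ->]]].
  exists (a * b), (s * u); split; try exact: subringM; first exact: nPM.
  by field; rewrite !nP_neq0.
Qed.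

Lemma localization_nonunitsP z :
  nonunits O z <-> exists a s, [/\ P a, A s, ~ P s & z = a / s].
Proof.
split=> [[[a [s [Aa As Ps ->]]] nu]|[a [s [Pa As Ps ->]]]].
  exists a, s; split=> //; apply: contrapT => Pa; case: nu => [/eqP|nu].
    by rewrite mulf_eq0 invr_eq0 (negPf (nP_neq0 Pa)) (negPf (nP_neq0 Ps)).
  by apply: nu; exists s, a; split=> //; rewrite invf_div.
split; first by exists a, s; split=> //; exact: PA.
have [->|a0] := eqVneq a 0; first by left; rewrite mul0r.
right=> -[b [u [Ab Au Pu]]]; rewrite invf_div => E.
have {}E : s * u = b * a by apply/eqP; rewrite -eqr_div ?E ?(nP_neq0 Pu).
have : P (s * u) by rewrite E; exact: PM.
exact: nPM.
Qed.

End Localization.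

Section FunctionField.
Variables (k : closedFieldType) (n : nat).
Local Notation K := (funfield k n).
Implicit Types (f g : {mpoly k[n]}) (m : 'X_{1..n}).

HB.instance Definition _ := GRing.RMorphism.copy (@regular k n)
  (@FracField.tofrac {mpoly k[n]}).

Lemma regular0 : regular (0 : {mpoly k[n]}) = 0.
Proof. exact: rmorph0. Qed.

Lemma regular1 : regular (1 : {mpoly k[n]}) = 1.
Proof. exact: rmorph1. Qed.

Lemma regularD f g : regular (f + g) = regular f + regular g.
Proof. exact: rmorphD. Qed.

Lemma regularN f : regular (- f) = - regular f.
Proof. exact: rmorphN. Qed.

Lemma regularM f g : regular (f * g) = regular f * regular g.
Proof. exact: rmorphM. Qed.

Lemma regularXn f e : regular (f ^+ e) = regular f ^+ e.
Proof. exact: rmorphXn. Qed.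

Lemma regular_sum (I : Type) (r : seq I) (P : pred I) (F : I -> {mpoly k[n]}) :
  regular (\sum_(i <- r | P i) F i) = \sum_(i <- r | P i) regular (F i).
Proof. exact: rmorph_sum. Qed.

Lemma regular_eq0 f : (regular f == 0) = (f == 0).
Proof. exact: tofrac_eq0. Qed.

Lemma regular_inj : injective (@regular k n).
Proof. by move=> f g /eqP; rewrite tofrac_eq => /eqP. Qed.

Lemma funfieldP (z : K) : exists f g, g != 0 /\ z = regular f / regular g.
Proof.
pose r := repr z; exists (\n_r), (\d_r); split; first exact: denom_ratioP.
have d0 : regular \d_r != 0 by rewrite regular_eq0 denom_ratioP.
apply: (mulIf d0); rewrite mulfVK//.
rewrite -[z]reprK -/r /regular; unlock FracField.tofrac.
rewrite -[LHS]FracField.pi_mul; apply/eqmodP => /=.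
rewrite FracField.equivfE /FracField.mulf /=.
by rewrite !numden_Ratio ?mulf_neq0 ?oner_neq0 ?denom_ratioP// !mulr1 mulrC.
Qed.

Lemma regularX m : regular 'X_[m] = \prod_i Defs.coord k i ^+ m i.
Proof.
by rewrite mpolyXE_id rmorph_prod; apply: eq_bigr => i _; rewrite rmorphXn.
Qed.

Lemma regularE f :
  regular f = \sum_(m <- msupp f) regular (f@_m)%:MP * regular 'X_[m].
Proof.
rewrite {1}[f]mpolyE rmorph_sum; apply: eq_bigr => m _.
by rewrite -mul_mpolyC rmorphM.
Qed.

Lemma mpolyX_neq0 m : 'X_[k, m] != 0.
Proof. by rewrite -msupp_eq0 msuppX. Qed.

Lemma coord_neq0 i : Defs.coord k i != 0 :> K.
Proof. by rewrite /coord regular_eq0 mpolyX_neq0. Qed.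

End FunctionField.

Section FieldDerivation.
Variables (K : fieldType) (D : K -> K).
Hypothesis derD : forall x y, D (x + y) = D x + D y.
Hypothesis derM : forall x y, D (x * y) = D x * y + x * D y.

Lemma der0 : D 0 = 0.
Proof. by apply: (addrI (D 0)); rewrite -derD !addr0. Qed.

Lemma der1 : D 1 = 0.
Proof.
by apply: (addrI (D 1)); rewrite addr0 -[in RHS](mulr1 1) derM mulr1 mul1r.
Qed.

Lemma der_sum (I : Type) (r : seq I) (P : pred I) (F : I -> K) :
  D (\sum_(i <- r | P i) F i) = \sum_(i <- r | P i) D (F i).
Proof. exact: (big_morph D derD der0). Qed.

Lemma derX x e : D (x ^+ e) = e%:R * x ^+ e.-1 * D x.
Proof.
elim: e => [|e IH]; first by rewrite der1 !mul0r.
rewrite exprS derM IH /=; case: e {IH} => [|e] /=.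
  by rewrite expr0; ring.
by rewrite exprS (mulrSr 1 e.+1); ring.
Qed.

Lemma der_div x y : y != 0 -> D (x / y) = (D x * y - x * D y) / y ^+ 2.
Proof. by move=> y0; have := derM (x / y) y; rewrite divfK// => ->; field. Qed.

End FieldDerivation.

Section Derivations.
Variables (k : closedFieldType) (n : nat).
Local Notation K := (funfield k n).

Lemma derivation_eq0 (D : K -> K) : derivation D ->
  (forall j, D (Defs.coord k j) = 0) -> forall z, D z = 0.
Proof.
move=> [DC DD DM] D0 z; have Dreg f : D (regular f) = 0.
  rewrite regularE (der_sum DD) big1// => m _.
  rewrite DM DC mul0r add0r regularX; apply/eqP; rewrite mulf_eq0.
  apply/orP; right; apply/eqP.
  apply: (big_ind (fun x => D x = 0)) => [|x y Dx Dy|i _].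
  - exact: der1 DM.
  - by rewrite DM Dx Dy mul0r mulr0 addr0.
  - by rewrite (derX DM) D0 mulr0.
have [f [g [g0 ->]]] := funfieldP z.
by rewrite (der_div DM) ?regular_eq0// !Dreg mul0r mulr0 subr0 mul0r.
Qed.

Lemma derivation_lincomb (T : finType) (D : T -> K -> K) (c : T -> K) :
  (forall i, derivation (D i)) -> derivation (fun z => \sum_i c i * D i z).
Proof.
move=> Dder; split=> [a|x y|x y].
- by rewrite big1// => i _; case: (Dder i) => -> _ _; rewrite mulr0.
- rewrite -big_split; apply: eq_bigr => i _; case: (Dder i) => _ -> _.
  by rewrite mulrDr.
- rewrite mulr_suml mulr_sumr -big_split; apply: eq_bigr => i _.
  by case: (Dder i) => _ _ ->; rewrite mulrDr mulrA mulrCA.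
Qed.

End Derivations.

Section DiscreteValuation.
Variables (K : fieldType) (O : set K) (t : K).
Hypotheses (Osub : is_subring O) (tunif : nonunits O = [set t * z | z in O]).
Hypothesis Odim : dim_one O.
Implicit Types z : K.

Definition div_unit z : Prop := [/\ O z, O z^-1 & z != 0].

Lemma div_unitM x y : div_unit x -> div_unit y -> div_unit (x * y).
Proof.
move=> [Ox Oxi x0] [Oy Oyi y0]; split; last exact: mulf_neq0.
  exact: subringM.
by rewrite invfM; exact: subringM.
Qed.

Lemma div_unit1 : div_unit 1.
Proof. by split; rewrite ?invr1 ?oner_neq0//; exact: subring1. Qed.

Lemma nonunitP z : nonunits O z <-> exists2 y, O y & z = t * y.
Proof.
by rewrite tunif; split=> [[y Oy <-]|[y Oy ->]]; exists y.
Qed.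

Lemma div_unitVnonunit z : O z -> div_unit z \/ exists2 y, O y & z = t * y.
Proof.
move=> Oz; have [|nz] := pselect (nonunits O z); first by move/nonunitP; right.
left; split=> //; first by apply: contrapT => Oi; apply: nz; split=> //; right.
by apply/eqP => z0; apply: nz; split=> //; left.
Qed.

Lemma div_unit_nonunit z : div_unit z -> ~ nonunits O z.
Proof. by move=> [_ Oi z0] [_ [/eqP|]//]; rewrite (negPf z0). Qed.

Lemma div_unif_nonunit : nonunits O t.
Proof. by apply/nonunitP; exists 1; rewrite ?mulr1//; exact: subring1. Qed.

Lemma div_ring_unif : O t.
Proof. by case: div_unif_nonunit. Qed.

Lemma div_unif_neq0 : t != 0.
Proof.
apply/eqP => t0; have [+ _] := Odim; apply; apply/seteqP; split=> z /=.
  by move/nonunitP => [y _ ->]; rewrite t0 mul0r.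
by move=> ->; apply/nonunitP; exists 0; rewrite ?mulr0//; exact: subring0.
Qed.

Let tX_neq0 e : t ^+ e != 0.
Proof. by rewrite expf_neq0// div_unif_neq0. Qed.

Definition div_ge e z : Prop := exists2 y, O y & z = t ^+ e * y.

(** A relation rather than a function, as the existence of an order for each nonzero element of O is
    only established in [div_valP]. *)
Definition div_val e z : Prop := exists2 u, div_unit u & z = t ^+ e * u.

Lemma div_val_ge e f z : div_val e z -> div_ge f z -> (f <= e)%N.
Proof.
move=> [u uu ->] [y Oy]; case: leqP => // ef.
rewrite -(subnKC (ltnW ef)) exprD -mulrA => /(mulfI (tX_neq0 e)) uE.
case: (div_unit_nonunit uu); apply/nonunitP; exists (t ^+ (f - e).-1 * y).
  by apply: subringM => //; apply: subringX => //; exact: div_ring_unif.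
by rewrite uE mulrA -exprS prednK// subn_gt0.
Qed.

Lemma div_val_self e z : div_val e z -> div_ge e z.
Proof. by move=> [u [Ou _ _] ->]; exists u. Qed.

(* The intersection of the powers of (t) is a prime ideal which does not
   contain t, so it is 0 by dimension one. *)
Lemma div_valP z : O z -> z != 0 -> exists e, div_val e z.
Proof.
move=> Oz z0.
have ge_step e y : div_ge e y -> ~ div_val e y -> div_ge e.+1 y.
  move=> [x Ox yE] nv; have [ux|[x' Ox' xE]] := div_unitVnonunit Ox.
    by case: nv; exists x.
  by exists x'; rewrite // exprSr -mulrA -xE.
have valV y : O y -> (exists e, div_val e y) \/ forall e, div_ge e y.
  move=> Oy; have [|nv] := pselect (exists e, div_val e y); [by left|right].
  elim=> [|e IH]; first by exists y; rewrite ?expr0 ?mul1r.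
  by apply: ge_step => // v; apply: nv; exists e.
have [//|zinf] := valV z Oz.
pose I := [set y | O y /\ forall e, div_ge e y].
have Iprime : prime_ideal O I.
  split.
  - split=> [y []//|]; split.
    * split; first exact: subring0.
      by move=> e; exists 0; rewrite ?mulr0//; exact: subring0.
    * move=> x y [Ox xi] [Oy yi]; split=> [|e]; first exact: subringD.
      have [x' Ox' ->] := xi e; have [y' Oy' ->] := yi e.
      by exists (x' + y'); rewrite ?mulrDr//; exact: subringD.
    * move=> a x Oa [Ox xi]; split=> [|e]; first exact: subringM.
      have [x' Ox' ->] := xi e.
      by exists (a * x'); rewrite 1?mulrCA//; exact: subringM.
  - move=> [_ /(_ 1%N)[y Oy]]; rewrite expr1 => E1.
    by apply: (div_unit_nonunit div_unit1); apply/nonunitP; exists y.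
  - move=> x y Ox Oy [_ xyi].
    have [[e [u uu xE]]|xi] := valV x Ox; last by left.
    have [[f [v uv yE]]|yi] := valV y Oy; last by right.
    have : div_val (e + f) (x * y).
      by exists (u * v); [exact: div_unitM|rewrite xE yE exprD; ring].
    by move/div_val_ge => /(_ (e + f).+1 (xyi _)); rewrite ltnn.
have I0 : I <> [set 0].
  by move=> E0; have : I z by []; rewrite E0 => /eqP; rewrite (negPf z0).
have [_ /(_ I Iprime I0) It] := Odim.
have := div_unif_nonunit; rewrite -It => -[_ /(_ 2%N)].
have : div_val 1 t by exists 1; rewrite ?expr1 ?mulr1//; exact: div_unit1.
by move=> /div_val_ge/[apply].
Qed.

(** An element of order exactly e generates (t^e), and the other elements of b lie in it. The
    equivalence also provides the uniqueness that is needed to evaluate the [xget] in [ordK]. *)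
Lemma div_ge_gen e (b : set K) :
  (forall z, b z -> div_ge e z) -> (exists2 z, b z & div_val e z) ->
  forall f, submodule_gen O b = [set t ^+ f * z | z in O] <-> f = e.
Proof.
move=> bge [z bz zval].
have genE : submodule_gen O b = [set t ^+ e * z | z in O].
  apply/seteqP; split.
    apply: smallest_sub; last by move=> x /bge[y Oy ->]; exists y.
    split.
    - by exists 0; rewrite ?mulr0//; exact: subring0.
    - move=> _ _ [x Ox <-] [y Oy <-]; exists (x + y); rewrite ?mulrDr//.
      exact: subringD.
    - move=> a _ Oa [x Ox <-]; exists (a * x); last by ring.
      exact: subringM.
  move=> _ [y Oy <-] J [[J0 JD JM] bJ].
  have [u [Ou Oui u0] zE] := zval.
  rewrite (_ : _ * y = (y * u^-1) * z); last by rewrite zE; field.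
  by apply: JM; [exact: subringM|exact: bJ].
move=> f; split=> [|->//]; rewrite genE => fE.
have : [set t ^+ f * z | z in O] (t ^+ e).
  by rewrite -fE; exists 1; rewrite ?mulr1//; exact: subring1.
have : [set t ^+ e * z | z in O] (t ^+ f).
  by rewrite fE; exists 1; rewrite ?mulr1//; exact: subring1.
have self d : div_val d (t ^+ d) by exists 1; rewrite ?mulr1//; exact: div_unit1.
move=> [x Ox xE] [y Oy yE]; apply/eqP; rewrite eqn_leq.
apply/andP; split; apply: div_val_ge (self _) _; [by exists y|by exists x].
Qed.

End DiscreteValuation.

Lemma chart_subring (k : closedFieldType) n (s : seq (funfield k n)) :
  is_subring (chart s).
Proof.
split=> [B [[]]//|y z Ay Az B BP|y z Ay Az B BP].
  by apply: subringB; [case: BP|exact: Ay|exact: Az].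
by apply: subringM; [case: BP|exact: Ay|exact: Az].
Qed.

Section Divisor.
Variables (k : closedFieldType) (n : nat) (E : divisor_over k n).
Local Notation K := (funfield k n).
Local Notation O := (div_ring E).
Local Notation t := (div_unif E).
Implicit Types (z : K) (m w : 'X_{1..n}).

Let OP : exists A P, [/\ is_subring A, range (@regular k n) `<=` A,
  prime_ideal A P & O = localization A P].
Proof.
have [[ss YE] _ _ _] := div_modelP E; have := div_ringP E; rewrite YE.
move=> [s _ [P Pprime <-]]; exists (chart s), P; split=> //.
  exact: chart_subring.
by move=> x xr; apply: sub_smallest xr; left.
Qed.

Lemma div_ring_subring : is_subring O.
Proof. have [A [P [Asub _ Pp ->]]] := OP; exact: localization_subring. Qed.
Let Osub := div_ring_subring.

Lemma div_ring_regular f : O (regular f).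
Proof.
have [A [P [Asub Ar Pp ->]]] := OP; apply: sub_localization => //.
by apply: Ar; exists f.
Qed.

Lemma ordKE e (b : set K) :
  (forall z, b z -> div_ge O t e z) -> (exists2 z, b z & div_val O t e z) ->
  ordK E b = e.
Proof.
move=> bge bval.
have genE := div_ge_gen Osub (div_unifP E) (div_codim1 E) bge bval.
by apply: xget_unique => /= [|f]; [apply/genE|move/genE].
Qed.

End Divisor.

Lemma div_valM (K : fieldType) (O : set K) (t : K) e f x y : is_subring O ->
  div_val O t e x -> div_val O t f y -> div_val O t (e + f) (x * y).
Proof.
move=> Osub [u uu ->] [v uv ->]; exists (u * v); first exact: div_unitM.
by rewrite exprD mulrACA.
Qed.

Lemma div_valX (K : fieldType) (O : set K) (t : K) e x d : is_subring O ->
  div_val O t e x -> div_val O t (e * d) (x ^+ d).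
Proof.
move=> Osub vx; elim: d => [|d IH]; last first.
  by rewrite exprS mulnS; exact: div_valM.
by rewrite muln0; exists 1; rewrite ?expr0 ?mulr1//; exact: div_unit1.
Qed.

Lemma div_val_prod (K : fieldType) (O : set K) (t : K) (T : Type)
    (r : seq T) (e : T -> nat) (x : T -> K) : is_subring O ->
  (forall i, div_val O t (e i) (x i)) ->
  div_val O t (\sum_(i <- r) e i) (\prod_(i <- r) x i).
Proof.
move=> Osub vx; elim: r => [|i r IH]; last by rewrite !big_cons; exact: div_valM.
by rewrite !big_nil; exists 1; rewrite ?expr0 ?mulr1//; exact: div_unit1.
Qed.

Lemma div_geW (K : fieldType) (O : set K) (t : K) e f z :
  is_subring O -> O t -> (e <= f)%N -> div_ge O t f z -> div_ge O t e z.
Proof.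
move=> Osub Ot ef [y Oy ->]; exists (t ^+ (f - e) * y).
  by apply: subringM => //; exact: subringX.
by rewrite mulrA -exprD subnKC.
Qed.

(* If d_i = D_i(t) and du_ij = D_i(u_j), then the first matrix M has entries
   D_i(t^{e_j} u_j), and bordering it with the column (t, d) gives the product
   of the second matrix with a triangular one. *)
Lemma det_log_derivative (R : comNzRingType) m (t : R) (e : 'I_m -> nat)
    (u d : 'I_m -> R) (du : 'I_m -> 'I_m -> R) :
  t * \det (\matrix_(i, j)
    ((e j)%:R * t ^+ (e j).-1 * d i * u j + t ^+ e j * du i j))
  = t ^+ (\sum_j e j) *
    \det (block_mx (t%:M : 'M_1) (\row_j - ((e j)%:R * u j))
      (\col_i d i) (\matrix_(i, j) du i j)).
Proof.
pose B := block_mx (1%:M : 'M[R]_1) (\row_j ((e j)%:R * t ^+ (e j).-1 * u j))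
  0 (diag_mx (\row_j t ^+ e j)).
rewrite -{1}[t](det_scalar1 t) -(det_lblock _ (\col_i d i)).
have -> : t ^+ (\sum_j e j) = \det B.
  rewrite det_ublock det1 mul1r det_diag (big_morph _ (exprD t) (expr0 t)).
  by apply: eq_bigr => j _; rewrite mxE.
rewrite mulrC -det_mulmx mulmx_block; congr (\det (block_mx _ _ _ _)).
- by rewrite mulmx1 mulmx0 addr0.
- apply/rowP => j; rewrite !mxE big_ord1 !mxE mulr1n.
  rewrite (bigD1 j)//= big1 => [|i ij]; last first.
    by rewrite !mxE (negPf ij) mulr0n mulr0.
  (* The exponent (e j).-1 is truncated at e j = 0, where the factor e j vanishes. *)
  rewrite !mxE eqxx mulr1n; case: (e j) => [|f] /=; first by ring.
  by rewrite exprS; ring.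
- by rewrite mulmx1 mulmx0 addr0.
- apply/matrixP => i j; rewrite !mxE big_ord1 !mxE.
  rewrite (bigD1 j)//= big1 => [|l lj]; last first.
    by rewrite !mxE (negPf lj) mulr0n mulr0.
  by rewrite !mxE eqxx mulr1n; ring.
Qed.

Section MinDot.
Variable n : nat.
Implicit Types (M : set 'X_{1..n}) (w : 'X_{1..n}).

(** The order at weight w of the ideal generated by the monomials in M. The default 0 for empty M
    never occurs for a nonzero ideal, see [exponents_nonempty]. *)
Definition min_dot M w : nat :=
  xget 0%N [set v | exists m, [/\ M m, dot m w = v &
                      forall m', M m' -> (v <= dot m' w)%N]].

Lemma min_dotP M w : M !=set0 ->
  exists m, [/\ M m, dot m w = min_dot M w &
                forall m', M m' -> (min_dot M w <= dot m' w)%N].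
Proof.
move=> [m1 Mm1].
have ex : exists v, `[< exists2 m, M m & dot m w = v >].
  by exists (dot m1 w); apply/asboolP; exists m1.
case: (ex_minnP ex) => v /asboolP[m Mm mE] vmin.
apply: (@xgetPex _ 0%N [set v | exists m, [/\ M m, dot m w = v &
  forall m', M m' -> (v <= dot m' w)%N]]).
by exists v, m; split=> // m' Mm'; apply: vmin; apply/asboolP; exists m'.
Qed.

Lemma order_fun_min_dot M : M !=set0 -> order_fun (min_dot M).
Proof.
move=> M0 w w_pos; have [m [Mm mE _]] := min_dotP w M0; exists m; split=> // w' _.
by have [_ [_ _]] := min_dotP w' M0; apply.
Qed.

End MinDot.

(** * Orders of monomial ideals and of the Jacobian along a divisor *)

Section Divisor.
Variables (k : closedFieldType) (n : nat) (E : divisor_over k n).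
Local Notation K := (funfield k n).
Local Notation O := (div_ring E).
Local Notation t := (div_unif E).
Local Notation x i := (Defs.coord k i : K).
Implicit Types (z : K) (m w : 'X_{1..n}).

Let Osub : is_subring O := div_ring_subring E.
Let Ot : O t := div_ring_unif Osub (div_unifP E).

Definition coord_vals w : Prop := forall i, div_val O t (w i) (x i).

Lemma coord_vals_exist : center E = closed_point (@origin k n) ->
  exists2 w, wpos w & coord_vals w.
Proof.
move=> cE.
have /choice[e eP] : forall i, exists e, (0 < e)%N /\ div_val O t e (x i).
  move=> i.
  have xn : nonunits O (x i).
    have : closed_point (@origin k n) 'X_i by rewrite /closed_point /= mevalXU.
    by rewrite -cE.
  have [|e ve] := div_valP Osub (div_unifP E) (div_codim1 E) _ (coord_neq0 k i).
    by case: xn.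
  exists e; split=> //; rewrite lt0n; apply/eqP => e0; move: ve; rewrite e0.
  move=> [u uu]; rewrite expr0 mul1r => xu.
  by apply: (div_unit_nonunit uu); rewrite -xu.
by exists [multinom e i | i < n] => i; rewrite mnmE; case: (eP i).
Qed.

Lemma monomial_val w m : coord_vals w -> div_val O t (dot m w) (regular 'X_[m]).
Proof.
move=> vx; rewrite regularX; apply: div_val_prod => // i.
by rewrite mulnC; exact: div_valX.
Qed.

(** No cancellation has to be excluded: a monomial of least weight lies in the ideal and has exactly
    this order, while the polynomials of at least this order form a submodule that contains the
    generators. *)
Lemma ord_monomial w (M : set 'X_{1..n}) : M !=set0 -> coord_vals w ->
  ord E (submodule_gen setT [set 'X_[k, m] | m in M]) = min_dot M w.
Proof.
move=> M0 vx; have [m0 [Mm0 m0E m0min]] := min_dotP w M0.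
apply: ordKE; last first.
  exists (regular 'X_[m0]); last by rewrite -m0E; exact: monomial_val.
  by exists 'X_[m0] => // J [_]; apply; exists m0.
move=> _ [f fM <-].
apply: (fM [set f | div_ge O t (min_dot M w) (regular f)]); split.
  split=> /=.
  - by exists 0; rewrite ?regular0 ?mulr0//; exact: subring0.
  - move=> f1 f2 [y1 O1 E1] [y2 O2 E2]; exists (y1 + y2); first exact: subringD.
    by rewrite regularD E1 E2 mulrDr.
  - move=> a f1 _ [y Oy Ey]; exists (regular a * y).
      by apply: subringM => //; exact: div_ring_regular.
    by rewrite regularM Ey mulrCA.
move=> _ [m Mm <-] /=; apply: (div_geW Osub Ot (m0min m Mm)).
by apply: div_val_self; exact: monomial_val.
Qed.

(* Otherwise a nontrivial combination of the D_i kills the x_j, hence all of K,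
   which contradicts D_i(y_j) = delta_ij. *)
Lemma jacobian_neq0 : jacobian E != 0.
Proof.
have [_ Dder _ Dy] := div_coordP E.
apply/negP => /det0P[v v0 vM].
have /derivation_eq0 D0 := derivation_lincomb (fun i => v 0 i) Dder.
case/negP: v0; apply/eqP/rowP => l; rewrite mxE.
have := D0 _ (div_coord E l); rewrite (bigD1 l)//= big1 => [|i il]; last first.
  by rewrite Dy (negPf il) mulr0.
rewrite Dy eqxx mulr1 addr0; apply=> j.
move/rowP: vM => /(_ j); rewrite !mxE => vM0.
by rewrite -[RHS]vM0; apply: eq_bigr => i _; rewrite mxE.
Qed.

Lemma jacobian_in : O (jacobian E).
Proof.
have [_ _ DO _] := div_coordP E; apply: subring_det => // i j; rewrite mxE.
by apply: DO; exact: div_ring_regular.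
Qed.

Lemma k_P : div_val O t (k_ E) (jacobian E).
Proof.
have [e ve] := div_valP Osub (div_unifP E) (div_codim1 E)
  jacobian_in jacobian_neq0.
suff -> : k_ E = e by [].
apply: ordKE => [_ ->|]; first exact: div_val_self.
by exists (jacobian E).
Qed.

(** Differentiating the powers of t costs a single power of t in the whole determinant, because the
    terms that contain derivatives of t form a matrix of rank one. So t * J is t^|w| times a
    determinant with entries in O, as the derivations preserve O. *)
Lemma mdeg_le_k w : coord_vals w -> (mdeg w <= (k_ E).+1)%N.
Proof.
move=> vx; have [_ Dder DO _] := div_coordP E.
have /choice[u uP] : forall j, exists u, div_unit O u /\ x j = t ^+ w j * u.
  by move=> j; have [u uu uE] := vx j; exists u.
have Jval : div_val O t (k_ E).+1 (t * jacobian E).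
  rewrite -add1n; apply: div_valM k_P => //.
  by exists 1; rewrite ?mulr1//; exact: div_unit1.
apply: (div_val_ge Osub (div_unifP E) (div_codim1 E) Jval).
have -> : jacobian E = \det (\matrix_(i, j)
    ((w j)%:R * t ^+ (w j).-1 * div_deriv E i t * u j
      + t ^+ w j * div_deriv E i (u j))).
  rewrite /jacobian; congr (\det _); apply/matrixP => i j; rewrite !mxE.
  have [_ ->] := uP j; case: (Dder i) => _ _ DM.
  by rewrite DM (derX DM).
rewrite det_log_derivative -mdegE.
eexists; last by [].
apply: subring_det => // i j; rewrite !mxE.
case: splitP => i' _; rewrite !mxE; case: splitP => j' _; rewrite !mxE.
- by case: eqP => _; rewrite ?mulr1n ?mulr0n//; exact: subring0.
- apply: subringN => //; apply: subringM => //; last by case: (uP j') => -[].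
  by apply: subringMn => //; exact: subring1.
- exact: DO.
- by apply: DO; case: (uP j') => -[].
Qed.

End Divisor.

(** * Integral closure *)

(** One denominator serves all powers of z: up to the degree of p each z is paired with a factor b,
    and higher powers are reduced by the equation. *)
Lemma integral_almost_integral (K : fieldType) (A : set K) (z b : K)
    (p : {poly K}) : is_subring A -> A b -> A (b * z) ->
  p \is monic -> (forall i, A p`_i) -> root p z ->
  forall i, A (b ^+ (size p).-1 * z ^+ i).
Proof.
move=> Asub Ab Abz pm Ap pz; set s := (size p).-1.
have ps : size p = s.+1 by rewrite /s prednK// size_poly_gt0 monic_neq0.
have zs : z ^+ s = - \sum_(j < s) p`_j * z ^+ j.
  move/eqP: pz; rewrite /root horner_coef ps big_ord_recr /= => /eqP.
  have -> : p`_s = 1 by move/monicP: pm; rewrite lead_coefE.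
  by rewrite mul1r addrC addr_eq0 => /eqP.
elim/ltn_ind=> i IH; have [lis|lsi] := leqP i s.
  rewrite -(subnK lis) exprD -mulrA -exprMn.
  by apply: subringM => //; exact: subringX.
rewrite -(subnK (ltnW lsi)) exprD zs mulrN mulrN mulr_sumr mulr_sumr.
apply: subringN => //; apply: subring_sum => // j _.
have -> : b ^+ s * (z ^+ (i - s) * (p`_j * z ^+ j))
    = p`_j * (b ^+ s * z ^+ (i - s + j)) by rewrite exprD; ring.
apply: subringM => //; apply: IH.
by rewrite -[ltnRHS](subnK (ltnW lsi)) ltn_add2l.
Qed.

Lemma almost_integralB (K : fieldType) (A : set K) (d z r : K) :
  is_subring A -> (forall i, A (d * z ^+ i)) -> A r ->
  forall i, A (d * (z - r) ^+ i).
Proof.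
move=> Asub Adz Ar i; rewrite exprBn mulr_sumr.
apply: subring_sum => // j _; rewrite mulrnAr; apply: subringMn => //.
have -> : d * ((-1) ^+ j * z ^+ (i - j) * r ^+ j)
  = (-1) ^+ j * (d * z ^+ (i - j)) * r ^+ j by ring.
apply: subringM => //; last exact: subringX.
by apply: subringM => //; exact: subring_sign.
Qed.

Section PolynomialRing.
Variables (k : closedFieldType) (n : nat).
Local Notation K := (funfield k n).
Implicit Types f g d : {mpoly k[n]}.

Lemma range_regular_subring : is_subring (range (@regular k n)).
Proof.
split.
- by exists 1 => //; rewrite regular1.
- by move=> _ _ [f _ <-] [g _ <-]; exists (f - g); rewrite // regularD regularN.
- by move=> _ _ [f _ <-] [g _ <-]; exists (f * g); rewrite // regularM.
Qed.

(** If the exponent of x_j in the leading monomial of g exceeded that of f, then in d f^N = g^N h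
    the right side would exceed f^N by at least N in this exponent. With N one more than the
    exponent of x_j for d, the factor d cannot compensate. *)
Lemma mlead_divides d f g : d != 0 -> f != 0 -> g != 0 ->
  (forall i, range (@regular k n) (regular d * (regular f / regular g) ^+ i)) ->
  (mlead g <= mlead f)%MM.
Proof.
move=> d0 f0 g0 dfg; apply/mnm_lepP => j; rewrite leqNgt; apply/negP => lt_fg.
have [h _ hE] := dfg (mlead d j).+1.
have {}hE : d * f ^+ (mlead d j).+1 = g ^+ (mlead d j).+1 * h.
  apply: (@regular_inj k n); rewrite !regularM !regularXn hE expr_div_n.
  rewrite [RHS]mulrCA; congr (_ * _).
  by rewrite mulrCA mulfV ?mulr1// expf_neq0// regular_eq0.
have h0 : h != 0.
  apply/eqP => h0; move/eqP: hE; rewrite h0 mulr0 mulf_eq0 expf_eq0.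
  by rewrite (negPf d0) (negPf f0).
move/(congr1 (fun p => mlead p j)): hE.
rewrite !mleadM ?expf_neq0// !mleadX// !mnmDE !mulmnE.
have : ((mlead f j).+1 * (mlead d j).+1 <= mlead g j * (mlead d j).+1)%N.
  by rewrite leq_mul2r lt_fg orbT.
rewrite mulSn => le_v E.
have := leq_addr (mlead h j) (mlead g j * (mlead d j).+1).
by rewrite -E => /(leq_trans le_v); rewrite leq_add2r ltnn.
Qed.

(* Dividing f by g with remainder: the hypothesis forces the leading monomial
   of every nonzero remainder to be divisible by that of g. *)
Lemma almost_integral_regular d f g : d != 0 -> g != 0 ->
  (forall i, range (@regular k n) (regular d * (regular f / regular g) ^+ i)) ->
  range (@regular k n) (regular f / regular g).
Proof.
move=> d0 g0; move: {2}(mlead f) (erefl (mlead f)) => m.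
elim/(@ltmwf n): m f => m IH f fm dfg.
have [->|f0] := eqVneq f 0; first by exists 0; rewrite // regular0 mul0r.
have gf := mlead_divides d0 f0 g0 dfg.
pose q := (mleadc f / mleadc g) *: 'X_[k, mlead f - mlead g].
pose f' := f - q * g.
have f'E : regular f' / regular g = regular f / regular g - regular q.
  by rewrite /f' regularD regularN regularM mulrBl mulfK// regular_eq0.
have ratE : regular f / regular g = regular f' / regular g + regular q.
  by rewrite f'E subrK.
have qr : range (@regular k n) (regular q) by exists q.
rewrite ratE; apply: (subringD range_regular_subring) => //.
have dfg' i : range (@regular k n) (regular d * (regular f' / regular g) ^+ i).
  by rewrite f'E; apply: almost_integralB => //; exact: range_regular_subring.
have [->|f'0] := eqVneq f' 0; first by exists 0; rewrite // regular0 mul0r.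
apply: (IH (mlead f')) => //; rewrite -fm lt_neqAle; apply/andP; split.
  apply/eqP => E; have := mlead_supp f'0.
  rewrite mcoeff_msupp E /f' /q mcoeffB -scalerAl mcoeffZ.
  have -> : ('X_[mlead f - mlead g] * g)@_(mlead f) = mleadc g.
    by rewrite mulrC -{1}(submK gf) mcoeffMX.
  by rewrite divfK ?mleadc_eq0// subrr eqxx.
have qg : mlead (q * g) = mlead f.
  have c0 : mleadc f / mleadc g != 0.
    by rewrite mulf_neq0 ?invr_eq0 ?mleadc_eq0.
  by rewrite /q -scalerAl mleadZ// mleadM ?mpolyX_neq0// mleadXm submK.
by apply: le_trans (mleadB_le _ _) _; rewrite qg joinxx.
Qed.

Lemma polynomial_ring_normal : integrally_closed (range (@regular k n)).
Proof.
move=> z p pm Ap pz; have [f [g [g0 zE]]] := funfieldP z.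
have rg f' : range (@regular k n) (regular f') by exists f'.
have Agz : range (@regular k n) (regular g * z).
  by rewrite zE mulrC divfK ?regular_eq0.
rewrite zE; apply: (@almost_integral_regular (g ^+ (size p).-1)) => //.
  exact: expf_neq0.
move=> i; rewrite -zE regularXn.
apply: integral_almost_integral => //; exact: range_regular_subring.
Qed.

End PolynomialRing.

Lemma valuation_ring_normal (K : fieldType) (V : set K) :
  valuation_ring V -> integrally_closed V.
Proof.
move=> [Vsub Vval] z p pm Vp pz.
have [//|Vi] := Vval z.
have [->|z0] := eqVneq z 0; first exact: subring0.
have V1 : V (z^-1 * z) by rewrite mulVf//; exact: subring1.
(* Take b = z^-1 and the power one above the degree s of p: b^s z^(s+1) is z itself. *)
have := integral_almost_integral Vsub Vi V1 pm Vp pz (size p).-1.+1.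
by rewrite exprS mulrCA -exprMn mulVf// expr1n mulr1.
Qed.

Lemma integral_scale (K : fieldType) (A : set K) (z s : K) (p : {poly K}) :
  is_subring A -> integrally_closed A -> A s -> p \is monic ->
  (forall i, A (s * p`_i)) -> root p z -> A (s * z).
Proof.
move=> Asub An As pm sp pz.
have ps : size p = (size p).-1.+1 by rewrite prednK// size_poly_gt0 monic_neq0.
pose N := (size p).-1.
(* q is s^N p(X / s), with root s z. Its lower coefficients s^(N-i) p_i are written so that only s
   p_i has to lie in A. *)
pose q := \poly_(i < N.+1) (if i == N then 1 else s ^+ (N - i).-1 * (s * p`_i)).
have qN : q`_N = 1 by rewrite coef_poly ltnSn eqxx.
have sq : size q = N.+1.
  by rewrite size_poly_eq// eqxx oner_neq0.
apply: (An _ q).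
- by apply/monicP; rewrite lead_coefE sq.
- move=> i; rewrite coef_poly; case: ltnP => _; last exact: subring0.
  case: eqP => _; first exact: subring1.
  by apply: subringM => //; exact: subringX.
- move/eqP: pz; rewrite horner_coef ps -/N => pz.
  apply/eqP; rewrite horner_coef sq -[RHS](mulr0 (s ^+ N)) -[X in _ = _ * X]pz.
  rewrite mulr_sumr.
  apply: eq_bigr => i _; rewrite coef_poly ltn_ord.
  case: eqP => [->|/eqP iN].
    have -> : p`_N = 1 by move/monicP: pm; rewrite lead_coefE.
    by rewrite !mul1r exprMn.
  have lt_iN : (i < N)%N by rewrite ltn_neqAle iN -ltnS /=.
  have -> : s ^+ N = s ^+ (N - i).-1 * s * s ^+ i.
    by rewrite -exprSr prednK ?subn_gt0// -exprD subnK// ltnW.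
  by rewrite exprMn; ring.
Qed.

Lemma common_denominator (K : fieldType) (A : set K) (S : K -> Prop)
    (p : {poly K}) : is_subring A -> S 1 ->
  (forall s u, S s -> S u -> S (s * u)) -> (forall s, S s -> A s) ->
  (forall i, exists2 s, S s & A (s * p`_i)) ->
  exists2 s, S s & forall i, A (s * p`_i).
Proof.
move=> Asub S1 SM SA Ap.
suff [s Ss sp] : exists2 s, S s & forall i, (i < size p)%N -> A (s * p`_i).
  exists s => // i; have [/sp//|pi] := ltnP i (size p).
  by rewrite nth_default// mulr0; exact: subring0.
elim: (size p) => [|N [s Ss sp]]; first by exists 1.
have [u Su up] := Ap N; exists (s * u); first exact: SM.
move=> i; rewrite ltnS leq_eqVlt => /predU1P[->|iN].
  by rewrite -mulrA; apply: subringM => //; exact: SA.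
by rewrite mulrAC; apply: subringM => //; [exact: sp|exact: SA].
Qed.

Lemma localization_normal (K : fieldType) (A P : set K) :
  is_subring A -> prime_ideal A P -> integrally_closed A ->
  integrally_closed (localization A P).
Proof.
move=> Asub Pprime An z p pm Ap pz.
have [[_ [P0 _ _]] P1 Pmul] := Pprime.
have P_neq0 s : ~ P s -> s != 0.
  by move=> Ps; apply/eqP => s0; apply: Ps; rewrite s0.
have [||||s [As Ps] sp] := @common_denominator K A (fun s => A s /\ ~ P s) p Asub.
- by split=> //; exact: subring1.
- by move=> s u [As Ps] [Au Pu]; split; [exact: subringM|case/Pmul].
- by move=> s [].
- move=> i; have [a [s [Aa As Ps ->]]] := Ap i; exists s => //.
  by rewrite mulrC divfK ?P_neq0.
exists (s * z), s; split=> //; last by rewrite mulrC mulKf ?P_neq0.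
exact: integral_scale sp pz.
Qed.

(** * Monomial valuations *)

Lemma coef_low_mul (R : comNzRingType) (p q : {poly R}) d e :
  (forall i, (i < d)%N -> p`_i = 0) -> (forall i, (i < e)%N -> q`_i = 0) ->
  (forall i, (i < d + e)%N -> (p * q)`_i = 0) /\
  (p * q)`_(d + e) = p`_d * q`_e.
Proof.
move=> pd qe; split=> [i ide|]; rewrite coefM.
  apply: big1 => j _; have [/pd->|dj] := ltnP j d; first by rewrite mul0r.
  rewrite qe ?mulr0//; have := ltn_ord j; lia.
have dlt : (d < (d + e).+1)%N by rewrite ltnS leq_addr.
rewrite (bigD1 (Ordinal dlt))//= addKn big1 ?addr0// => j jd.
have [/pd->|dj] := ltnP j d; first by rewrite mul0r.
have {}jd : (j != d :> nat) by apply: contraNneq jd => jd; apply/eqP/val_inj.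
rewrite qe ?mulr0//; have := ltn_ord j; lia.
Qed.

Section MonomialValuation.
Variables (k : closedFieldType) (n : nat) (w : 'X_{1..n}).
Local Notation K := (funfield k n).
Implicit Types (f g : {mpoly k[n]}) (m : 'X_{1..n}) (z : K).

(* f(T^{w_1} x_1, ..., T^{w_n} x_n), whose order of vanishing at T = 0 is the
   least weight of a monomial of f. *)
Definition weight_poly : {mpoly k[n]} -> {poly {mpoly k[n]}} :=
  mmap (@polyC {mpoly k[n]} \o @mpolyC n k)
    (fun i => ('X_i)%:P * 'X^(w i)).

Lemma weight_polyM f g : weight_poly (f * g) = weight_poly f * weight_poly g.
Proof. exact: rmorphM. Qed.

Lemma weight_poly_coef f d m :
  (weight_poly f)`_d@_m = f@_m *+ (dot m w == d).
Proof.
have mm1 m' : mmap1 (fun i => ('X_i : {mpoly k[n]})%:P * 'X^(w i)) m'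
    = ('X_[m'])%:P * 'X^(dot m' w).
  rewrite /mmap1 [in RHS]mpolyXE_id rmorph_prod.
  rewrite (big_morph _ (exprD 'X) (expr0 'X)) -big_split; apply: eq_bigr => i _ /=.
  by rewrite exprMn rmorphXn /= -exprM mulnC.
have E : weight_poly f = \sum_(m' <- msupp f)
    (f@_m' *: 'X_[m'])%:P * 'X^(dot m' w).
  apply: eq_bigr => m' _; rewrite mm1 mulrA; congr (_ * _).
  by rewrite /= -polyCM mul_mpolyC.
rewrite {}E coef_sum raddf_sum /=.
have [mf|mf] := boolP (m \in msupp f); last first.
  rewrite (memN_msupp_eq0 mf) mul0rn big1_seq// => m' /andP[_ m'f].
  rewrite coefCM coefXn mulr_natr mcoeffMn mcoeffZ mcoeffX.
  by case: eqP => [m'm|_]; [rewrite -m'm m'f in mf|rewrite mulr0 mul0rn].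
rewrite (bigD1_seq m) ?msupp_uniq//= big1 => [|m' m'm]; last first.
  rewrite coefCM coefXn mulr_natr mcoeffMn mcoeffZ mcoeffX (negPf m'm).
  by rewrite mulr0 mul0rn.
rewrite coefCM coefXn mulr_natr mcoeffMn mcoeffZ mcoeffX eqxx mulr1 addr0.
by rewrite eq_sym.
Qed.

(* Locked to prevent conversion from computing with polynomials. *)
Fact wval_key : unit. Proof. exact: tt. Qed.
Definition wval f : nat :=
  locked_with wval_key find (fun c => c != 0) (weight_poly f).

Lemma weight_poly_low f i : (i < wval f)%N -> (weight_poly f)`_i = 0.
Proof. by rewrite /wval unlock => /(before_find 0)/negbFE/eqP. Qed.

Lemma wval_le f m : m \in msupp f -> (wval f <= dot m w)%N.
Proof.
rewrite mcoeff_msupp leqNgt; apply: contra => /weight_poly_low E.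
by have := weight_poly_coef f (dot m w) m; rewrite E mcoeff0 eqxx mulr1n => <-.
Qed.

Lemma weight_poly_wval f : f != 0 -> (weight_poly f)`_(wval f) != 0.
Proof.
move=> f0; have sf : wval f = find (fun c => c != 0) (weight_poly f).
  by rewrite /wval unlock.
rewrite sf; apply: (@nth_find _ _ (fun c => c != 0)).
rewrite has_find ltnNge -sf; apply/negP => {}sf.
have := mlead_supp f0; rewrite mcoeff_msupp => /negP; apply.
have := weight_poly_coef f (dot (mlead f) w) (mlead f).
rewrite eqxx mulr1n => <-.
suff -> : (weight_poly f)`_(dot (mlead f) w) = 0 by rewrite mcoeff0.
by rewrite nth_default// (leq_trans sf)// wval_le// mlead_supp.
Qed.

Lemma wval_unique f d : (forall i, (i < d)%N -> (weight_poly f)`_i = 0) ->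
  (weight_poly f)`_d != 0 -> wval f = d.
Proof.
move=> low nz; apply/eqP; rewrite eqn_leq; apply/andP; split.
  by rewrite leqNgt; apply: contra nz => /weight_poly_low->.
have f0 : f != 0.
  by apply: contraNneq nz => ->; rewrite /weight_poly mmap0 coef0.
rewrite leqNgt; apply/negP => /low.
by move/eqP; rewrite (negPf (weight_poly_wval f0)).
Qed.

(** The lowest coefficients in T have a nonzero product, since k[x] is a domain. *)
Lemma wvalM f g : f != 0 -> g != 0 -> wval (f * g) = (wval f + wval g)%N.
Proof.
move=> f0 g0.
have [low E] := coef_low_mul (@weight_poly_low f) (@weight_poly_low g).
apply: wval_unique; rewrite weight_polyM// E.
by rewrite mulf_neq0// weight_poly_wval.
Qed.

(** Phrased through the support, which makes sums immediate and includes f = 0. The bound is an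
    integer because quotients will have negative values. *)
Definition wge (e : int) f : Prop :=
  forall m, m \in msupp f -> e <= (dot m w)%:Z.

Lemma wgeP e f : wge e f <-> f = 0 \/ e <= (wval f)%:Z.
Proof.
split=> [ef|[->|ef]].
- have [|f0] := eqVneq f 0; [by left|right].
  have [m mf md] : exists2 m, m \in msupp f & dot m w = wval f.
    have := weight_poly_wval f0; rewrite -mleadc_eq0 weight_poly_coef.
    set m := mlead _; case: (dot m w =P wval f) => [<- nz|_]; last first.
      by rewrite mulr0n eqxx.
    by exists m; rewrite // mcoeff_msupp.
  by rewrite -md; exact: ef.
- by move=> m; rewrite msupp0.
- by move=> m /wval_le mf; apply: le_trans ef _; rewrite lez_nat.
Qed.

Lemma wgeD e f g : wge e f -> wge e g -> wge e (f + g).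
Proof.
by move=> ef eg m /msuppD_le; rewrite mem_cat => /orP[/ef|/eg].
Qed.

Lemma wgeM d e f g : wge d f -> wge e g -> wge (d + e) (f * g).
Proof.
move=> /wgeP[->|df] /wgeP[->|eg]; rewrite ?(mul0r, mulr0);
  try by apply/wgeP; left.
apply/wgeP; have [->|f0] := eqVneq f 0; first by rewrite mul0r; left.
have [->|g0] := eqVneq g 0; first by rewrite mulr0; left.
by right; rewrite wvalM// PoszD; exact: lerD df eg.
Qed.

Lemma wvalX m : wval 'X_[m] = dot m w.
Proof.
apply/eqP; rewrite eqn_leq wval_le ?msuppX ?mem_head//=.
have /wgeP[/eqP|] : wge (dot m w) 'X_[m].
- by move=> m'; rewrite msuppX inE => /eqP->.
- by rewrite (negPf (mpolyX_neq0 _ _)).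
- by rewrite lez_nat.
Qed.

Lemma wvalC (c : k) : c != 0 -> wval c%:MP = 0%N.
Proof.
move=> c0; apply/eqP; rewrite -leqn0 -(dot0 w) wval_le//.
by rewrite msuppC (negPf c0) mem_head.
Qed.

Lemma wval1 : wval 1 = 0%N.
Proof. by rewrite -mpolyC1 wvalC// oner_neq0. Qed.

(* The junk value [valn 0] is 0. *)
Definition valn z : int :=
  xget 0 [set v | exists f g, [/\ f != 0, g != 0, z = regular f / regular g &
                     v = (wval f)%:Z - (wval g)%:Z]].

Lemma valn_frac f g : f != 0 -> g != 0 ->
  valn (regular f / regular g) = (wval f)%:Z - (wval g)%:Z.
Proof.
move=> f0 g0; apply: xget_unique => [|v [f' [g' [f'0 g'0 E ->]]]].
  by exists f, g.
have : f * g' = f' * g.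
  apply: (@regular_inj k n); rewrite !regularM; apply/eqP.
  by rewrite -eqr_div ?regular_eq0// E.
move/(congr1 wval); rewrite (wvalM f0 g'0) (wvalM f'0 g0).
by move: (wval f) (wval g) (wval f') (wval g'); lia.
Qed.

Lemma valn_regular f : f != 0 -> valn (regular f) = (wval f)%:Z.
Proof.
move=> f0; have := valn_frac f0 (oner_neq0 _).
by rewrite regular1 divr1 wval1 subr0.
Qed.

Lemma funfieldP_neq0 z : z != 0 ->
  exists f g, [/\ f != 0, g != 0 & z = regular f / regular g].
Proof.
have [f [g [g0 ->]]] := funfieldP z => fg; exists f, g; split=> //.
by apply: contraNneq fg => ->; rewrite regular0 mul0r.
Qed.

Lemma valnM x y : x != 0 -> y != 0 -> valn (x * y) = valn x + valn y.
Proof.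
move=> /funfieldP_neq0[f [g [f0 g0 ->]]] /funfieldP_neq0[f' [g' [f'0 g'0 ->]]].
rewrite mulf_div -!regularM valn_frac ?mulf_neq0//.
rewrite (wvalM f0 f'0) (wvalM g0 g'0) (valn_frac f0 g0) (valn_frac f'0 g'0).
by move: (wval f) (wval g) (wval f') (wval g'); lia.
Qed.

Lemma valnV x : x != 0 -> valn x^-1 = - valn x.
Proof.
move=> /funfieldP_neq0[f [g [f0 g0 ->]]].
by rewrite invf_div (valn_frac f0 g0) (valn_frac g0 f0) opprB.
Qed.

Lemma valn1 : valn 1 = 0.
Proof. by rewrite -(regular1 k n) valn_regular ?oner_neq0// wval1. Qed.

Lemma valnX x e : x != 0 -> valn (x ^+ e) = valn x * e%:Z.
Proof.
move=> x0; elim: e => [|e IH]; first by rewrite expr0 valn1 mulr0.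
by rewrite exprS valnM ?expf_neq0// IH -addn1 PoszD mulrDr mulr1 addrC.
Qed.

Lemma valn_coord i : valn (Defs.coord k i) = (w i)%:Z.
Proof. by rewrite valn_regular ?mpolyX_neq0// wvalX dot1. Qed.

(** The disjunct z = 0 stands for the value of 0 being infinite. *)
Definition vge (e : int) z : Prop := z = 0 \/ e <= valn z.

Lemma vge_frac e f g : g != 0 ->
  vge e (regular f / regular g) <-> wge (e + (wval g)%:Z) f.
Proof.
move=> g0; split=> [[/eqP|ef]|/wgeP[->|ef]].
- rewrite mulf_eq0 invr_eq0 !regular_eq0 (negPf g0) orbF => /eqP ->.
  by apply/wgeP; left.
- have [->|f0] := eqVneq f 0; first by apply/wgeP; left.
  by apply/wgeP; right; move: ef; rewrite valn_frac// lerBrDr.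
- by left; rewrite regular0 mul0r.
- have [->|f0] := eqVneq f 0; first by left; rewrite regular0 mul0r.
  by right; rewrite valn_frac// lerBrDr.
Qed.

Lemma vge_regular e f : vge e (regular f) <-> wge e f.
Proof.
have := @vge_frac e f 1 (oner_neq0 _).
by rewrite regular1 divr1 wval1 addr0.
Qed.

Lemma vge0 e : vge e 0. Proof. by left. Qed.

Lemma vgeW d e z : d <= e -> vge e z -> vge d z.
Proof. by move=> de [->|ez]; [left|right; exact: le_trans ez]. Qed.

Lemma vgeM d e x y : vge d x -> vge e y -> vge (d + e) (x * y).
Proof.
move=> [->|dx] [->|ey]; rewrite ?(mul0r, mulr0); try exact: vge0.
have [->|x0] := eqVneq x 0; first by rewrite mul0r; exact: vge0.
have [->|y0] := eqVneq y 0; first by rewrite mulr0; exact: vge0.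
by right; rewrite (valnM x0 y0); apply: lerD.
Qed.

Lemma vgeX e x i : vge e x -> vge (e * i%:Z) (x ^+ i).
Proof.
move=> ex; elim: i => [|i IH]; first by rewrite mulr0 expr0; right; rewrite valn1.
by rewrite exprS -addn1 PoszD mulrDr mulr1 addrC; exact: vgeM.
Qed.

Lemma vgeD e x y : vge e x -> vge e y -> vge e (x + y).
Proof.
have [f [g [g0 ->]]] := funfieldP x; have [f' [g' [g'0 ->]]] := funfieldP y.
move=> /vge_frac-/(_ g0) ef /vge_frac-/(_ g'0) ef'.
rewrite addf_div ?regular_eq0// -!regularM -regularD.
apply/vge_frac; first exact: mulf_neq0.
have gg : wge (wval g) g by apply/wgeP; right.
have gg' : wge (wval g') g' by apply/wgeP; right.
rewrite wvalM// PoszD; apply: wgeD.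
  by rewrite addrA; exact: wgeM.
by rewrite [(wval g)%:Z + _]addrC addrA; exact: wgeM.
Qed.

Lemma vgeN e x : vge e x -> vge e (- x).
Proof.
move=> ex; rewrite -mulN1r -[e]add0r; apply: vgeM => //.
by right; rewrite -(regular1 k n) -regularN valn_regular ?oppr_eq0 ?oner_neq0.
Qed.

Lemma vge_neq0 e z : z != 0 -> vge e z -> e <= valn z.
Proof. by move=> z0 [/eqP|//]; rewrite (negPf z0). Qed.

Definition weight_ring : set K := vge 0.
Local Notation V := weight_ring.

Lemma weight_ring_subring : is_subring V.
Proof.
split.
- by right; rewrite valn1.
- by move=> x y Vx Vy; apply: vgeD => //; exact: vgeN.
- by move=> x y Vx Vy; rewrite /V -[0]addr0; exact: vgeM.
Qed.

Lemma weight_ring_valuation : valuation_ring V.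
Proof.
split; first exact: weight_ring_subring.
move=> z; have [->|z0] := eqVneq z 0; first by left; left.
have [z_ge|z_lt] := leP 0 (valn z); first by left; right.
by right; right; rewrite valnV// oppr_ge0 ltW.
Qed.

Lemma weight_ring_regular f : V (regular f).
Proof. by apply/vge_regular => m _; rewrite lez_nat. Qed.

Lemma weight_ring_nonunits : nonunits V = vge 1.
Proof.
apply/seteqP; split=> z.
- move=> [Vz [->|nV]]; first exact: vge0.
  have [->|z0] := eqVneq z 0; first exact: vge0.
  right; rewrite -gtz0_ge1 lt_neqAle (vge_neq0 z0 Vz) andbT.
  by apply/eqP => E; apply: nV; right; rewrite valnV// -E oppr0.
- move=> z1; split; first by apply: vgeW z1.
  have [|z0] := eqVneq z 0; [by left|right].
  have zi0 : z^-1 != 0 by rewrite invr_eq0.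
  move=> /(vge_neq0 zi0); rewrite (valnV z0).
  by have := vge_neq0 z0 z1; lia.
Qed.

Lemma weight_ring_uniformizer t : valn t = 1 -> t != 0 ->
  nonunits V = [set t * z | z in V].
Proof.
move=> t1 t0; rewrite weight_ring_nonunits; apply/seteqP; split=> z.
- move=> z1; exists (z / t); last by rewrite mulrC divfK.
  rewrite /V -[0](subrr 1); apply: vgeM => //.
  by right; rewrite valnV// t1.
- by move=> [y Vy <-]; rewrite -[1]addr0; apply: vgeM => //; right; rewrite t1.
Qed.

Lemma weight_ring_dim_one t : valn t = 1 -> t != 0 -> dim_one V.
Proof.
move=> t1 t0; split.
  move=> E; have : nonunits V t by rewrite weight_ring_nonunits; right; rewrite t1.
  by rewrite E => /eqP; rewrite (negPf t0).
move=> P [[PV [P0 PD PM]] P1 Pmul] PN0.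
have [z Pz z0] : exists2 z, P z & z != 0.
  apply: contrapT => noz; apply: PN0; apply/seteqP; split=> z /=; last by move=> ->.
  by move=> Pz; apply/eqP; apply: contrapT => /negP z0; apply: noz; exists z.
apply/seteqP; split=> y Py.
  rewrite weight_ring_nonunits; have [->|y0] := eqVneq y 0; first exact: vge0.
  right; rewrite -gtz0_ge1 lt_neqAle (vge_neq0 y0 (PV _ Py)) andbT.
  apply/eqP => E; apply: P1; rewrite -(mulVf y0); apply: PM => //.
  by right; rewrite valnV// -E oppr0.
have [Vy _] := Py; move: Py; rewrite weight_ring_nonunits => y1.
have Ppow i : P (y ^+ i) -> P y.
  elim: i => [//|i IH]; rewrite exprS => /Pmul[]//.
  by apply: subringX => //; exact: weight_ring_subring.
(* With v the value of the nonzero element z of P, y^v / z has nonnegative value, since y has value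
   at least 1. So y^v lies in P. *)
apply: (Ppow `|valn z|%N).
rewrite -[y ^+ _](mulfVK z0); apply: PM => //.
rewrite /V -[0](subrr (valn z)); apply: vgeM; last by right; rewrite valnV.
have := vgeX `|valn z|%N y1; rewrite mul1r gez0_abs//.
exact: vge_neq0 (PV _ Pz).
Qed.

End MonomialValuation.

(** * Arbitrary valuation rings and their centers *)

Section ValuationRing.
Variables (K : fieldType) (V : set K).
Hypothesis Vval : valuation_ring V.

Let Vsub : is_subring V. Proof. by case: Vval. Qed.

Lemma valuation_nonunits_ideal : is_ideal V (nonunits V).
Proof.
have ideal_mul a x : V a -> nonunits V x -> nonunits V (a * x).
  move=> Va [Vx nx]; split; first exact: subringM.
  have [->|ax0] := eqVneq (a * x) 0; [by left|right].
  have [a0 x0] : a != 0 /\ x != 0.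
    by move: ax0; rewrite mulf_eq0 => /norP.
  move=> Vi; case: nx => [/eqP|]; first by rewrite (negPf x0).
  have -> : x^-1 = a * (a * x)^-1 by field; rewrite a0 x0.
  by apply; exact: subringM.
split=> [x []//|]; split=> //.
  by split; [exact: subring0|left].
move=> x y nx ny.
have [->|x0] := eqVneq x 0; first by rewrite add0r.
have [->|y0] := eqVneq y 0; first by rewrite addr0.
have [xy|xy] := Vval.2 (x / y).
  have -> : x + y = (x / y + 1) * y by field.
  by apply: ideal_mul => //; apply: subringD => //; exact: subring1.
rewrite invf_div in xy.
have -> : x + y = (1 + y / x) * x by field.
by apply: ideal_mul => //; apply: subringD => //; exact: subring1.
Qed.

Lemma valuation_root z e : (0 < e)%N -> V (z ^+ e) -> V z.
Proof.
case: e => // e _ Vz; have [//|Vi] := Vval.2 z.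
have [->|z0] := eqVneq z 0; first exact: subring0.
have -> : z = z ^+ e.+1 * z^-1 ^+ e.
  by rewrite exprSr exprVn mulrAC divff ?mul1r// expf_neq0.
by apply: subringM => //; exact: subringX.
Qed.

(** Divisibility in V is a total preorder, so a finite family has an element of least value. It
    selects the chart on which a valuation has its center. *)
Lemma valuation_min (I : eqType) (y : I -> K) (s : seq I) i0 : i0 \in s ->
  (forall i, y i != 0) -> exists2 i, i \in s & forall j, j \in s -> V (y j / y i).
Proof.
move=> + y0; elim: s i0 => [//|a s IH] i0 _.
case: s IH => [_|b s /(_ b (mem_head _ _))[i is_ imin]].
  exists a; rewrite ?mem_head// => j; rewrite inE => /eqP->.
  by rewrite divff//; exact: subring1.
have [ia|ai] := Vval.2 (y i / y a).
  exists a; rewrite ?mem_head// => j; rewrite inE => /predU1P[->|/imin ji].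
    by rewrite divff//; exact: subring1.
  have -> : y j / y a = y j / y i * (y i / y a) by rewrite mulrA divfK.
  exact: subringM.
exists i; first by rewrite inE is_ orbT.
move=> j; rewrite inE => /predU1P[->|/imin//].
by rewrite -invf_div.
Qed.

(** The center of V on Spec A: elements of A outside this prime are units of V, so the localization
    stays inside V. Used both for properness and to find the generic point of the exceptional
    divisor. *)
Lemma valuation_center (A : set K) : is_subring A -> A `<=` V ->
  prime_ideal A (A `&` nonunits V) /\
  dominates V (localization A (A `&` nonunits V)).
Proof.
move=> Asub AV; have [_ [N0 ND NM]] := valuation_nonunits_ideal.
have nV1 : ~ nonunits V 1.
  by move=> [_ [/eqP|]]; rewrite ?oner_eq0// invr1; apply; exact: subring1.
have unitV s : A s -> ~ (A `&` nonunits V) s -> V s^-1.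
  move=> As ns; apply: contrapT => Vi; apply: ns; split=> //; split.
    exact: AV.
  by right.
have Pprime : prime_ideal A (A `&` nonunits V).
  split.
  - split=> [x []//|]; split.
    + by split=> //; exact: subring0.
    + by move=> x y [Ax nx] [Ay ny]; split; [exact: subringD|exact: ND].
    + by move=> a x Aa [Ax nx]; split; [exact: subringM|apply: NM => //; exact: AV].
  - by case.
  - move=> x y Ax Ay [_ nxy].
    have [Px|nPx] := pselect ((A `&` nonunits V) x); [by left|right].
    split=> //.
    have x0 : x != 0.
      by apply: contra_notN nPx => /eqP->; split=> //; exact: subring0.
    by rewrite -[y](mulKf x0); apply: NM => //; exact: unitV.
split=> //; split.
  move=> _ [a [s [Aa As Ps ->]]]; apply: subringM => //; [exact: AV|exact: unitV].
move=> z /(localization_nonunitsP Pprime)[a [s [[_ na] As Ps ->]]].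
by rewrite mulrC; apply: NM => //; exact: unitV.
Qed.

End ValuationRing.

(* z^(prod w) is a product of the elements of the hypothesis. *)
Lemma valuation_weighted_monomial (K : fieldType) (V : set K) (n : nat)
    (x : 'I_n -> K) (w m : 'X_{1..n}) (i : 'I_n) (N : nat) :
  valuation_ring V -> wpos w -> (forall j, x j != 0) -> V (x i) ->
  (forall j, V (x j ^+ ((\prod_l w l) %/ w j)%N /
                x i ^+ ((\prod_l w l) %/ w i)%N)) ->
  (N * w i <= dot m w)%N -> V (\prod_j x j ^+ m j / x i ^+ N).
Proof.
move=> Vval w_pos x0 Vxi; set W := (\prod_l w l)%N => Vx Nm.
have Vsub := Vval.1.
have W_gt0 : (0 < W)%N by rewrite prodn_gt0.
have We j : (W %/ w j * w j)%N = W by rewrite divnK// /W (bigD1 j)//= dvdn_mulr.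
apply: (valuation_root Vval W_gt0).
(* If x_j has weight w_j, all y_j have the same weight W, so their values can be compared without
   fractions. *)
set y := fun j => x j ^+ (W %/ w j).
have y0 j : y j != 0 by rewrite expf_neq0.
have -> : (\prod_j x j ^+ m j / x i ^+ N) ^+ W
  = \prod_j (y j / y i) ^+ (m j * w j) * y i ^+ (dot m w - N * w i).
  have yE j e : y j ^+ (e * w j) = x j ^+ (e * W).
    by rewrite /y -exprM mulnCA We.
  rewrite expr_div_n -exprM -yE -prodrXl.
  under [in RHS]eq_bigr do rewrite expr_div_n yE exprM.
  rewrite big_split /= prodfV -expr_sum -/(dot m w).
  by rewrite -mulrA -{1}(subnKC Nm) exprD invfM mulfVK ?expf_neq0.
apply: subringM => //; last by apply: subringX => //; exact: subringX.
by apply: subring_prod => // j _; apply: subringX => //; exact: Vx.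
Qed.

(** * Weighted blowups *)

(** The denominators s are units of V, hence units of the local ring of A1 by domination, so A2 is
    contained in that ring. An element of A2 outside P2 is a unit of V too, so the same argument
    inverts it. *)
Lemma separated_le (K : fieldType) (V A1 P1 A2 P2 : set K) :
  valuation_ring V -> is_subring A1 -> prime_ideal A1 P1 ->
  is_subring A2 -> prime_ideal A2 P2 ->
  dominates V (localization A1 P1) -> dominates V (localization A2 P2) ->
  (forall z, A2 z -> exists s, [/\ A1 s, s != 0, V s^-1 & A1 (s * z)]) ->
  localization A2 P2 `<=` localization A1 P1.
Proof.
move=> Vval A1sub P1prime A2sub P2prime [_ d1] [d2 _] A21.
have [[_ [P20 _ _]] _ _] := P2prime.
have O1sub := localization_subring A1sub P1prime.
have unit1 s : localization A1 P1 s -> V s^-1 -> s != 0 ->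
    localization A1 P1 s^-1.
  move=> Os Vs s0; apply: contrapT => Oi.
  have /d1[_ [/eqP|//]] : nonunits (localization A1 P1) s by split=> //; right.
  by rewrite (negPf s0).
have sub1 := sub_localization A1sub P1prime.
have le1 z : A2 z -> localization A1 P1 z.
  move=> /A21[s [As s0 Vs Asz]]; rewrite -[z](mulKf s0).
  by apply: subringM => //; [apply: unit1 => //; exact: sub1|exact: sub1].
move=> _ [a [s [Aa As Ps ->]]]; apply: subringM => //; first exact: le1.
have s0 : s != 0 by apply/eqP => s0; apply: Ps; rewrite s0.
apply: unit1 => //; first exact: le1.
apply: d2; exists 1, s; split=> //; first exact: subring1.
by rewrite div1r.
Qed.

Section WeightedBlowup.
Variables (k : closedFieldType) (n : nat) (w : 'X_{1..n}).
Hypothesis w_pos : wpos w.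
Local Notation K := (funfield k n).
Local Notation x i := (Defs.coord k i : K).
Local Notation V := (@weight_ring k n w).
Local Notation R := (range (@regular k n)).
Implicit Types (f : {mpoly k[n]}) (m : 'X_{1..n}) (z : K) (i j : 'I_n).

Let Vsub : is_subring V := weight_ring_subring k w.
Let Rsub : is_subring R := range_regular_subring k n.

Lemma regular_coordX i e : R (x i ^+ e).
Proof. by exists ('X_i ^+ e); rewrite // regularXn. Qed.

Lemma regular_coord i : R (x i).
Proof. by exists 'X_i. Qed.

(* The coordinate ring of the i-th affine chart of the weighted blowup with
   weight w, i.e. the degree 0 part of the Rees algebra localized at x_i. *)
Definition chart_ring i : set K := [set z | V z /\ exists N, R (x i ^+ N * z)].

Lemma chart_ring_regular i : R `<=` chart_ring i.
Proof.
move=> z [f _ <-]; split; first exact: weight_ring_regular.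
by exists 0%N; rewrite expr0 mul1r; exists f.
Qed.

Lemma chart_ring_subring i : is_subring (chart_ring i).
Proof.
split.
- by apply: chart_ring_regular; exact: subring1.
- move=> y z [Vy [N Ny]] [Vz [M Mz]]; split; first exact: subringB.
  exists (N + M)%N; rewrite mulrBr exprD; apply: subringB => //.
    by rewrite mulrAC; apply: subringM => //; exact: regular_coordX.
  by rewrite -mulrA; apply: subringM => //; exact: regular_coordX.
- move=> y z [Vy [N Ny]] [Vz [M Mz]]; split; first exact: subringM.
  by exists (N + M)%N; rewrite exprD mulrACA; exact: subringM.
Qed.

Lemma monomial_in_weight_ring m i N : (N * w i <= dot m w)%N ->
  V (regular 'X_[m] / x i ^+ N).
Proof.
move=> Nm; right; rewrite valnM ?invr_eq0 ?expf_neq0 ?coord_neq0//; last first.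
  by rewrite regular_eq0 mpolyX_neq0.
rewrite valnV ?expf_neq0 ?coord_neq0// valnX ?coord_neq0// valn_coord.
by rewrite valn_regular ?mpolyX_neq0// wvalX subr_ge0 -PoszM lez_nat mulnC.
Qed.

Lemma monomial_in_chart_ring m i N : (N * w i <= dot m w)%N ->
  chart_ring i (regular 'X_[m] / x i ^+ N).
Proof.
move=> Nm; split; first exact: monomial_in_weight_ring.
by exists N; rewrite mulrC divfK ?expf_neq0 ?coord_neq0.
Qed.

(** The value of a polynomial is the least weight of its monomials, so membership in V passes to
    each term: the chart ring is spanned by Laurent monomials. *)
Lemma chart_ring_sum z i : chart_ring i z -> exists N f,
  [/\ forall m, m \in msupp f -> (N * w i <= dot m w)%N &
      z = \sum_(m <- msupp f) regular (f@_m)%:MP * (regular 'X_[m] / x i ^+ N)].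
Proof.
move=> [Vz [N [f _ fE]]]; exists N, f; split.
  have : vge w ((N * w i)%N : int) (regular f).
    rewrite fE -[X in vge w X]addr0; apply: vgeM => //.
    by right; rewrite valnX ?coord_neq0// valn_coord PoszM mulrC.
  by move/vge_regular => fge m /fge; rewrite lez_nat.
have x0 : x i ^+ N != 0 by rewrite expf_neq0// coord_neq0.
rewrite -[z](mulKf x0) -fE regularE mulr_sumr; apply: eq_bigr => m _.
by rewrite mulrC mulrA.
Qed.

(** Exponents up to w_i suffice, because a factor x_j^(w_i) can be split off as x_j^(w_i) /
    x_i^(w_j), which is itself a generator. The quotient by w_i is the largest power of x_i that
    keeps the value nonnegative. *)
Definition chart_gens i : seq K :=
  [seq regular 'X_[[multinom (e j : nat) | j < n]] /
       x i ^+ (dot [multinom (e j : nat) | j < n] w %/ w i)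
  | e : {ffun 'I_n -> 'I_(w i).+1}].

Lemma monomial_in_chart m i N : (N * w i <= dot m w)%N ->
  chart (chart_gens i) (regular 'X_[m] / x i ^+ N).
Proof.
have Csub := chart_subring (chart_gens i).
have CR : R `<=` chart (chart_gens i).
  by move=> z Rz; apply: sub_smallest Rz; left.
have gen m' : (forall j, (m' j <= w i)%N) -> chart (chart_gens i)
    (regular 'X_[m'] / x i ^+ (dot m' w %/ w i)).
  move=> le_m'; pose e := [ffun j => Ordinal (le_m' j : (m' j < (w i).+1)%N)].
  have m'E : m' = [multinom (e j : nat) | j < n].
    by apply/mnmP => j; rewrite mnmE ffunE.
  have : [set` chart_gens i] (regular 'X_[m'] / x i ^+ (dot m' w %/ w i)).
    by apply/mapP; exists e; rewrite ?mem_enum // -m'E.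
  by apply: sub_smallest; right.
have x0 e : x i ^+ e != 0 by rewrite expf_neq0// coord_neq0.
have [d] := ubnP (mdeg m); elim: d m N => // d IH m N; rewrite ltnS => md Nm.
have [[j wj]|le_m] := pselect (exists j, w i < m j)%N; last first.
  have {}le_m j : (m j <= w i)%N.
    by rewrite leqNgt; apply/negP => lt_m; apply: le_m; exists j.
  have Nq : (N <= dot m w %/ w i)%N by rewrite leq_divRL.
  have -> : regular 'X_[m] / x i ^+ N = regular 'X_[m] / x i ^+ (dot m w %/ w i)
      * x i ^+ (dot m w %/ w i - N).
    rewrite -{1}(subnKC Nq) exprD invfM mulrA mulfVK//.
  by apply: (subringM Csub); [exact: gen|apply: CR; exact: regular_coordX].
pose u := (U_(j) *+ w i)%MM.
have um : (u <= m)%MM.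
  apply/mnm_lepP => l; rewrite mulmnE mnm1E; case: eqP => [<-|_].
    by rewrite mul1n ltnW.
  by rewrite mul0n.
have uw : dot u w = (w j * w i)%N by rewrite dotMl dot1.
have mE : m = (u + (m - u))%MM by rewrite addmC submK.
have du : (dot m w = w j * w i + dot (m - u) w)%N by rewrite {1}mE dotDl uw.
(* The subtractions are truncated: if N < w j, the second denominator is 1 and the surplus power of
   x_i is returned by the last factor; otherwise the last factor is 1. *)
have -> : regular 'X_[m] / x i ^+ N
    = (regular 'X_[u] / x i ^+ w j)
    * (regular 'X_[(m - u)] / x i ^+ (N - w j)) * x i ^+ (w j - N).
  rewrite {1}mE mpolyXD regularM.
  have -> : x i ^+ N = x i ^+ w j * x i ^+ (N - w j) / x i ^+ (w j - N).
    apply: (mulIf (x0 (w j - N)%N)); rewrite divfK// -!exprD; congr (_ ^+ _); lia.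
  by rewrite invf_div mulf_div mulrA [LHS]mulrAC.
apply: (subringM Csub); last by apply: CR; exact: regular_coordX.
apply: (subringM Csub).
  have := gen u; rewrite uw mulnK; last exact: w_pos.
  by apply=> l; rewrite mulmnE mnm1E; case: eqP; rewrite ?mul1n ?mul0n.
apply: IH.
  apply: leq_trans md; have /(congr1 mdeg) -> := mE.
  by rewrite mdegD mdegMn mdeg1 mul1n -[ltnLHS]add0n ltn_add2r w_pos.
by rewrite mulnBl leq_subLR -du.
Qed.

Lemma chart_gensE i : chart (chart_gens i) = chart_ring i.
Proof.
apply/seteqP; split.
  apply: smallest_sub; first exact: chart_ring_subring.
  move=> z [/chart_ring_regular//|/= /mapP[e _ ->]].
  by apply: monomial_in_chart_ring; exact: leq_divM.
have Csub := chart_subring (chart_gens i).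
move=> z /chart_ring_sum[N [f [fN ->]]]; rewrite big_seq.
apply: (subring_sum Csub) => m /fN Nm; apply: (subringM Csub).
  by move=> B [_ BP]; apply: BP; left; exists (f@_m)%:MP.
exact: monomial_in_chart.
Qed.

(** An intersection of normal rings: integral elements lie in V, and by clearing powers of x_i they
    lie in the localization of k[x] at x_i. *)
Lemma chart_ring_normal i : integrally_closed (chart_ring i).
Proof.
move=> z p pm Ap pz; split.
  apply: (valuation_ring_normal (weight_ring_valuation k w)) pm _ pz.
  by move=> j; case: (Ap j).
have [||||s [N ->] sp] :=
  @common_denominator K R (fun s => exists N, s = x i ^+ N) p Rsub.
- by exists 0%N.
- by move=> _ _ [N ->] [M ->]; exists (N + M)%N; rewrite exprD.
- by move=> _ [N ->]; exact: regular_coordX.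
- by move=> j; have [_ [N]] := Ap j; exists (x i ^+ N) => //; exists N.
exists N; apply: integral_scale sp pz => //.
  exact: polynomial_ring_normal.
exact: regular_coordX.
Qed.

End WeightedBlowup.

Section WeightedBlowupModel.
Variables (k : closedFieldType) (n : nat) (w : 'X_{1..n}).
Hypothesis w_pos : wpos w.
Local Notation K := (funfield k n).
Local Notation x i := (Defs.coord k i : K).
Local Notation V := (@weight_ring k n w).
Local Notation R := (range (@regular k n)).
Local Notation A := (@chart_ring k n w).
Implicit Types (f : {mpoly k[n]}) (m : 'X_{1..n}) (z : K) (i j : 'I_n).

Let Vsub : is_subring V := weight_ring_subring k w.
Let Rsub : is_subring R := range_regular_subring k n.
Let Asub i : is_subring (A i) := chart_ring_subring k w i.
Let x0 i e : x i ^+ e != 0. Proof. by rewrite expf_neq0// coord_neq0. Qed.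

Definition weighted_blowup : set (set K) :=
  [set O | exists2 s, s \in [seq @chart_gens k n w i | i <- enum 'I_n] &
             affine_points (chart s) O].

Lemma weighted_blowupP O : weighted_blowup O <->
  exists i P, prime_ideal (A i) P /\ O = localization (A i) P.
Proof.
split=> [[s /mapP[i _ ->] []]|[i [P [Pp ->]]]].
  by rewrite (chart_gensE k w_pos) => P Pp <-; exists i, P.
exists (chart_gens k w i); first by apply: map_f; rewrite mem_enum.
by rewrite (chart_gensE k w_pos); exists P.
Qed.

Lemma chart_transition i j : A i (x j ^+ w i / x i ^+ w j).
Proof.
have := @monomial_in_chart_ring k n w (U_(j) *+ w i)%MM i (w j).
by rewrite -mpolyXn regularXn; apply; rewrite dotMl dot1.
Qed.

(** The transition function u = x_j^(w_i) / x_i^(w_j) lies in A i and its inverse in A j, so u^-1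
    lies in U. A power of u clears the denominators x_j of an element of A j. *)
Lemma weighted_blowup_separated_le (U : set K) i j Pi Pj :
  valuation_ring U -> prime_ideal (A i) Pi -> prime_ideal (A j) Pj ->
  dominates U (localization (A i) Pi) -> dominates U (localization (A j) Pj) ->
  localization (A j) Pj `<=` localization (A i) Pi.
Proof.
move=> Uval Pip Pjp di dj.
apply: (separated_le Uval (Asub i) Pip (Asub j) Pjp di dj).
move=> z [Vz [N Nz]]; pose u := x j ^+ w i / x i ^+ w j.
have Au : A i (u ^+ N) by apply: subringX => //; exact: chart_transition.
exists (u ^+ N); split=> //.
- by rewrite expf_neq0// mulf_neq0// invr_eq0.
- rewrite -exprVn; apply: subringX; first exact: Uval.1.
  rewrite invf_div; case: dj => + _; apply.
  by apply: sub_localization => //; exact: chart_transition.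
- split; first by apply: subringM => //; case: Au.
  exists (w j * N)%N.
  have -> : x i ^+ (w j * N) * (u ^+ N * z)
      = x j ^+ ((w i).-1 * N) * (x j ^+ N * z).
    rewrite exprM !mulrA -exprMn mulrC [X in z * X ^+ _]mulrC divfK//.
    rewrite [RHS]mulrC -exprD; congr (_ * _); rewrite -exprM; congr (_ ^+ _).
    by rewrite addnC -mulSn prednK.
  by apply: subringM => //; exact: regular_coordX.
Qed.

Lemma weighted_blowup_separated : Defs.separated weighted_blowup.
Proof.
move=> U O1 O2 Uval /weighted_blowupP[i [Pi [Pip ->]]].
move=> /weighted_blowupP[j [Pj [Pjp ->]]] d1 d2; apply/seteqP.
split.
  exact: (weighted_blowup_separated_le Uval Pjp Pip d2 d1).
exact: (weighted_blowup_separated_le Uval Pip Pjp d1 d2).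
Qed.

(** With v the valuation of U, the chart is one where v(x_i) / w_i is least, tested on the powers
    x_j^(W / w_j) with W the product of the weights. The Laurent monomials that span A i then lie in
    U, so U has a center on this chart. *)
Lemma weighted_blowup_universally_closed : (0 < n)%N ->
  universally_closed weighted_blowup.
Proof.
move=> n_gt0 U Uval UR.
have [i _ imin] := valuation_min Uval (mem_enum 'I_n (Ordinal n_gt0))
  (fun j => x0 j ((\prod_l w l) %/ w j)%N).
have AU : A i `<=` U.
  move=> z /chart_ring_sum[N [f [fN ->]]]; rewrite big_seq.
  apply: (subring_sum Uval.1) => m /fN Nm; apply: (subringM Uval.1).
    by apply: UR; exists (f@_m)%:MP.
  rewrite regularX; apply: (valuation_weighted_monomial Uval w_pos) Nm.
  - by move=> j; exact: coord_neq0.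
  - by apply: UR; exact: regular_coord.
  - by move=> j; apply: imin; rewrite mem_enum.
have [Pp dom] := valuation_center Uval (Asub i) AU.
exists (localization (A i) (A i `&` nonunits U)) => //.
by apply/weighted_blowupP; exists i, (A i `&` nonunits U).
Qed.

Lemma weighted_blowup_model : (0 < n)%N ->
  normal_proper_birational weighted_blowup.
Proof.
move=> n_gt0; split.
- by exists [seq @chart_gens k n w i | i <- enum 'I_n].
- exact: weighted_blowup_separated.
- exact: weighted_blowup_universally_closed.
- move=> O /weighted_blowupP[i [P [Pp ->]]].
  by apply: localization_normal => //; exact: chart_ring_normal.
Qed.

(* If v(g) = d, then g^{w_i} / x_i^d is a function on the i-th chart of value 0,
   which serves as a denominator of f / g. *)
Lemma weight_ring_in_blowup : (0 < n)%N -> weighted_blowup V.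
Proof.
move=> n_gt0; pose i := Ordinal n_gt0.
have AV : A i `<=` V by move=> z [].
have [Pp [LV _]] := valuation_center (weight_ring_valuation k w) (Asub i) AV.
apply/weighted_blowupP; exists i, (A i `&` nonunits V); split=> //.
apply/seteqP; split=> // z Vz; have [f [g [g0 zE]]] := funfieldP z.
have rg e : regular g ^+ e != 0 by rewrite expf_neq0// regular_eq0.
pose s := regular g ^+ w i / x i ^+ wval w g.
have s0 : s != 0 by rewrite mulf_neq0// invr_eq0.
have vs : valn w s = 0.
  have xi0 : (x i ^+ wval w g)^-1 != 0 by rewrite invr_eq0 x0.
  have rg0 : regular g != 0 by rewrite regular_eq0.
  rewrite (valnM w (rg _) xi0) (valnV w (x0 _ _)) (valnX w _ rg0).
  rewrite (valnX w _ (coord_neq0 k i)) (valn_regular w g0) valn_coord.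
  by rewrite mulrC subrr.
have Vs : V s by right; rewrite vs.
exists (s * z), s; split.
- split; first exact: subringM.
  exists (wval w g); have -> : x i ^+ wval w g * (s * z)
      = regular g ^+ (w i).-1 * regular f.
    have frac_id (F : fieldType) (X a b : F) e : X != 0 -> a != 0 ->
        X * (a ^+ e.+1 / X * (b / a)) = a ^+ e * b.
      by move=> X0 a0; rewrite exprSr; field; rewrite X0 a0.
    have := frac_id K _ _ (regular f) (w i).-1 (x0 i (wval w g)) (rg 1%N).
    by rewrite expr1 prednK// -zE.
  exists (g ^+ (w i).-1 * f) => //.
  by rewrite regularM regularXn.
- split; first exact: Vs.
  exists (wval w g); rewrite mulrC (divfK (x0 _ _)).
  by exists (g ^+ w i); rewrite ?regularXn.
- move=> [_]; rewrite weight_ring_nonunits => -[/eqP|]; first by rewrite (negPf s0).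
  by rewrite vs.
- by rewrite mulrC mulKf.
Qed.

End WeightedBlowupModel.

(** * Differential forms on the weighted blowup *)

(** The second equation is the derivative of the first, so the quotient rule does not depend on how
    the fraction is written. *)
Lemma quotient_rule_wf (F : fieldType) (a b a' b' da db da' db' : F) :
  b != 0 -> b' != 0 -> a * b' = a' * b ->
  da * b' + a * db' = da' * b + a' * db ->
  (da * b - a * db) / b ^+ 2 = (da' * b' - a' * db') / b' ^+ 2.
Proof.
move=> b0 b'0 E dE.
have {E}aE : a' = a * b' / b by rewrite E mulfK.
have {dE}daE : da' = (da * b' + a * db' - a' * db) / b by rewrite dE addrK mulfK.
by rewrite daE aE; field; rewrite b0 b'0.
Qed.

Lemma quotient_rule_add (F : fieldType) (a b a' b' da db da' db' : F) :
  b != 0 -> b' != 0 ->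
  ((da * b' + a * db' + (da' * b + a' * db)) * (b * b')
    - (a * b' + a' * b) * (db * b' + b * db')) / (b * b') ^+ 2
  = (da * b - a * db) / b ^+ 2 + (da' * b' - a' * db') / b' ^+ 2.
Proof. by move=> b0 b'0; field; rewrite b0 b'0. Qed.

Lemma quotient_rule_mul (F : fieldType) (a b a' b' da db da' db' : F) :
  b != 0 -> b' != 0 ->
  ((da * a' + a * da') * (b * b') - (a * a') * (db * b' + b * db'))
    / (b * b') ^+ 2
  = (da * b - a * db) / b ^+ 2 * (a' / b')
    + a / b * ((da' * b' - a' * db') / b' ^+ 2).
Proof. by move=> b0 b'0; field; rewrite b0 b'0. Qed.

Section PartialDerivatives.
Variables (k : closedFieldType) (n : nat).
Local Notation K := (funfield k n).
Local Notation reg := (@regular k n).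
Local Notation x i := (Defs.coord k i : K).
Implicit Types (f g : {mpoly k[n]}) (m : 'X_{1..n}) (z : K).

Lemma partial_exists (i : 'I_n) : exists D : K -> K,
  derivation D /\ forall f, D (reg f) = reg (mderiv i f).
Proof.
pose q f g := (reg (mderiv i f) * reg g - reg f * reg (mderiv i g)) / reg g ^+ 2.
have reg0 g : g != 0 -> reg g != 0 by rewrite regular_eq0.
have qwf f g f' g' : g != 0 -> g' != 0 -> reg f / reg g = reg f' / reg g' ->
    q f g = q f' g'.
  move=> g0 g'0 /eqP; rewrite eqr_div ?reg0// -!regularM.
  move=> /eqP/(@regular_inj k n) E.
  apply: quotient_rule_wf; rewrite ?reg0//; first by rewrite -!regularM E.
  by rewrite -!regularM -!regularD -!mderivM E.
(* The value is specified for all representations of z at once, so each derivation law can be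
   checked on a convenient one. *)
have /choice[D DP] : forall z, exists d, forall f g, g != 0 ->
    z = reg f / reg g -> d = q f g.
  move=> z; have [f [g [g0 zE]]] := funfieldP z; exists (q f g) => f' g' g'0 zE'.
  by apply: qwf => //; rewrite -zE.
have Dreg f : D (reg f) = reg (mderiv i f).
  rewrite (DP _ f 1 (oner_neq0 _)) ?regular1 ?divr1// /q -mpolyC1 mderivC mpolyC1.
  by rewrite regular0 regular1 mulr0 subr0 mulr1 expr1n divr1.
exists D; split=> //; split=> [c|y z|y z].
- by rewrite Dreg mderivC regular0.
- have [f [g [g0 yE]]] := funfieldP y; have [f' [g' [g'0 zE]]] := funfieldP z.
  rewrite (DP _ _ _ g0 yE) (DP _ _ _ g'0 zE).
  rewrite (DP _ (f * g' + f' * g) (g * g')) ?mulf_neq0//.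
    rewrite /q mderivD !mderivM !(regularM, regularD).
    by apply: quotient_rule_add; exact: reg0.
  by rewrite yE zE addf_div ?reg0// !(regularM, regularD).
- have [f [g [g0 yE]]] := funfieldP y; have [f' [g' [g'0 zE]]] := funfieldP z.
  rewrite (DP _ _ _ g0 yE) (DP _ _ _ g'0 zE).
  rewrite (DP _ (f * f') (g * g')) ?mulf_neq0//.
    rewrite /q !mderivM !(regularM, regularD) [in RHS]yE [in RHS]zE.
    by apply: quotient_rule_mul; exact: reg0.
  by rewrite yE zE mulf_div !regularM.
Qed.

Definition partial i : K -> K := projT1 (cid (partial_exists i)).

Lemma partial_derivation i : derivation (partial i).
Proof. by rewrite /partial; case: cid => D []. Qed.

Lemma partial_regular i f : partial i (reg f) = reg (mderiv i f).
Proof. by rewrite /partial; case: cid => D []. Qed.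

(* The derivation sum_l c_l x_l d/dx_l, with x^m as eigenvectors. *)
Definition log_derivation (c : 'I_n -> k) z : K :=
  \sum_l (reg (c l)%:MP * x l) * partial l z.

Definition log_weight (c : 'I_n -> k) m : k := \sum_l c l * (m l)%:R.

Lemma log_derivation_derivation c : derivation (log_derivation c).
Proof. by apply: derivation_lincomb => l; exact: partial_derivation. Qed.

Lemma log_derivation_monomial c m :
  log_derivation c (reg 'X_[m]) = reg (log_weight c m)%:MP * reg 'X_[m].
Proof.
have sumE : (log_weight c m)%:MP * 'X_[k, m]
    = \sum_l (c l)%:MP * 'X_l * (mderiv l 'X_[m]).
  rewrite /log_weight raddf_sum mulr_suml; apply: eq_bigr => l _.
  rewrite mderivX -scalerAr !mul_mpolyC -scalerAl scalerA mulrC.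
  have [->|m0] := eqVneq (m l) 0%N; first by rewrite mul0r !scale0r.
  by rewrite -mpolyXD addmC submK ?lep1mP// mulrC.
rewrite -regularM sumE regular_sum; apply: eq_bigr => l _.
by rewrite !regularM partial_regular.
Qed.

Definition log_poly c f : {mpoly k[n]} :=
  \sum_(m <- msupp f) (f@_m * log_weight c m) *: 'X_[m].

Lemma log_derivation_regular c f :
  log_derivation c (reg f) = reg (log_poly c f).
Proof.
have [DC DD DM] := log_derivation_derivation c.
rewrite regularE (der_sum DD) regular_sum.
apply: eq_bigr => m _; rewrite DM DC mul0r add0r.
rewrite log_derivation_monomial -!regularM mulrA -mpolyCM.
by rewrite mul_mpolyC.
Qed.

Lemma log_derivation_laurent c p q :
  log_derivation c (reg 'X_[p] / reg 'X_[q])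
  = reg (log_weight c p - log_weight c q)%:MP * (reg 'X_[p] / reg 'X_[q]).
Proof.
have [DC DD DM] := log_derivation_derivation c.
have q0 : reg 'X_[q] != 0 by rewrite regular_eq0 mpolyX_neq0.
rewrite (der_div DM)// !log_derivation_monomial mpolyCB regularD regularN.
have frac_id (F : fieldType) (a b u v : F) : b != 0 ->
    (u * a * b - a * (v * b)) / b ^+ 2 = (u - v) * (a / b).
  by move=> b0; field.
exact: frac_id.
Qed.

End PartialDerivatives.

Section WeightRingDerivations.
Variables (k : closedFieldType) (n : nat) (w : 'X_{1..n}).
Local Notation K := (funfield k n).
Local Notation reg := (@regular k n).
Local Notation x i := (Defs.coord k i : K).
Local Notation V := (@weight_ring k n w).
Implicit Types (f g : {mpoly k[n]}) (m : 'X_{1..n}) (z : K).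

Lemma wgeZ e (a : k) f : wge w e f -> wge w e (a *: f).
Proof. by move=> ef m /msuppZ_le/ef. Qed.

Lemma wge_sum e (I : eqType) (r : seq I) (F : I -> {mpoly k[n]}) :
  (forall i, i \in r -> wge w e (F i)) -> wge w e (\sum_(i <- r) F i).
Proof.
move=> eF; rewrite big_seq; apply: (big_ind (wge w e)) => //.
- by apply/wgeP; left.
- by move=> f g; exact: wgeD.
Qed.

Lemma wge_X e m : e <= (dot m w)%:Z -> wge w e ('X_[k, m]).
Proof. by move=> em m'; rewrite msuppX inE => /eqP->. Qed.

Lemma wge_log_poly e c f : wge w e f -> wge w e (log_poly c f).
Proof.
by move=> ef; apply: wge_sum => m mf; apply: wgeZ; apply: wge_X; exact: ef.
Qed.

Lemma log_derivation_frac c f g : g != 0 ->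
  log_derivation c (reg f / reg g)
  = reg (log_poly c f * g - f * log_poly c g) / reg (g ^+ 2).
Proof.
move=> g0; have [_ _ DM] := log_derivation_derivation c.
rewrite (der_div DM) ?regular_eq0// !log_derivation_regular.
by rewrite regularXn regularD regularN !regularM.
Qed.

Lemma wvalX2 g : g != 0 -> wval w (g ^+ 2) = (wval w g + wval w g)%N.
Proof. by move=> g0; rewrite expr2 wvalM. Qed.

(** On polynomials the derivation is diagonal in the monomials, so it cannot lower the weight; the
    quotient rule extends this to fractions. *)
Lemma vge_log_derivation e c z : vge w e z -> vge w e (log_derivation c z).
Proof.
have [f [g [g0 ->]]] := funfieldP z => /(vge_frac _ _ _ g0) ef.
have gg : wge w (wval w g) g by apply/wgeP; right.
rewrite (log_derivation_frac _ _ g0).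
apply/vge_frac; first exact: expf_neq0.
rewrite (wvalX2 g0) PoszD addrA; apply: wgeD.
  by apply: wgeM => //; exact: wge_log_poly.
rewrite -scaleN1r; apply: wgeZ.
by apply: wgeM => //; exact: wge_log_poly.
Qed.

(* On the part of weight d the Euler derivation is multiplication by d. *)
Lemma vge_euler_derivation z : V z ->
  vge w 1 (log_derivation (fun l => (w l)%:R) z).
Proof.
have [f [g [g0 ->]]] := funfieldP z => /(vge_frac _ _ _ g0); rewrite add0r => ef.
set c := fun l => _; set d := wval w g in ef *.
have lwE m : log_weight c m = (dot m w)%:R.
  by rewrite /log_weight natr_sum; apply: eq_bigr => l _; rewrite natrM mulrC.
have shift h : wge w d h -> wge w (d%:Z + 1) (log_poly c h - d%:R *: h).
  move=> dh; rewrite {2}[h]mpolyE scaler_sumr -sumrB.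
  apply: wge_sum => m mh; rewrite scalerA -scalerBl lwE mulrC -mulrBl.
  have [E|dm] := eqVneq (dot m w) d.
    by rewrite E subrr mul0r scale0r; apply/wgeP; left.
  apply: wgeZ; apply: wge_X; move: (dh m mh) dm.
  by rewrite -PoszD !lez_nat addn1 ltn_neqAle eq_sym => -> ->.
have gg : wge w d g by apply/wgeP; right.
rewrite (log_derivation_frac _ _ g0).
apply/vge_frac; first exact: expf_neq0.
(* Subtracting d f and d g leaves the numerator unchanged, and both differences have weight at least
   d + 1. *)
have -> : log_poly c f * g - f * log_poly c g
    = (log_poly c f - d%:R *: f) * g - f * (log_poly c g - d%:R *: g).
  rewrite mulrBl mulrBr -scalerAl -scalerAr opprB addrA.
  by rewrite subrK.
rewrite (wvalX2 g0) -/d PoszD; apply: wgeD.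
  by rewrite addrA [1 + _]addrC; apply: wgeM => //; exact: shift.
rewrite -scaleN1r; apply: wgeZ.
by rewrite addrCA [1 + _]addrC; apply: wgeM => //; exact: shift.
Qed.

End WeightRingDerivations.

Section MonomialDivisor.
Variables (k : closedFieldType) (n : nat) (w p q : 'X_{1..n}).
Hypotheses (char_k0 : [pchar k] =i pred0) (n_gt0 : (0 < n)%N).
Hypotheses (w_pos : wpos w) (pqw : dot p w = (dot q w).+1).
Local Notation K := (funfield k n).
Local Notation reg := (@regular k n).
Local Notation x i := (Defs.coord k i : K).
Local Notation V := (@weight_ring k n w).
Implicit Types (f g : {mpoly k[n]}) (m : 'X_{1..n}) (z : K) (i j l : 'I_n).

Let i0 : 'I_n := Ordinal n_gt0.

Let X_neq0 m : reg 'X_[m] != 0.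
Proof. by rewrite regular_eq0 mpolyX_neq0. Qed.

(* The coordinates of V are t = x^p / x^q and y_j = x_j^{w_0} / x_0^{w_j} for
   j <> 0, where 0 stands for i0: the exponent vectors form a Q-basis of Q^n,
   and [dual_weight] is the dual basis. *)
Definition exp_num j : 'X_{1..n} := if j == i0 then p else (U_(j) *+ w i0)%MM.
Definition exp_den j : 'X_{1..n} := if j == i0 then q else (U_(i0) *+ w j)%MM.

Definition dual_weight i l : k :=
  if i == i0 then (w l)%:R
  else ((i == l)%:R - ((p i)%:R - (q i)%:R) * (w l)%:R) / (w i0)%:R.

(** Characteristic 0 makes the denominator of [dual_weight] invertible. *)
Let w0_neq0 : (w i0)%:R != 0 :> k.
Proof. by move/pcharf0P: char_k0 => ->; rewrite -lt0n. Qed.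

Let log_weightE i m : log_weight (dual_weight i) m =
  if i == i0 then (dot m w)%:R
  else ((m i)%:R - ((p i)%:R - (q i)%:R) * (dot m w)%:R) / (w i0)%:R.
Proof.
have dotE : (dot m w)%:R = \sum_l (w l)%:R * (m l)%:R :> k.
  by rewrite natr_sum; apply: eq_bigr => l _; rewrite natrM mulrC.
rewrite /log_weight /dual_weight; case: eqP => _; first by rewrite dotE.
rewrite dotE mulr_sumr.
have -> : (m i)%:R = \sum_l (i == l)%:R * (m l)%:R :> k.
  rewrite (bigD1 i)//= eqxx mul1r big1 ?addr0// => l li.
  by rewrite eq_sym (negPf li) mul0r.
by rewrite -sumrB mulr_suml; apply: eq_bigr => l _; ring.
Qed.

(** The weight functional is 1 on t and 0 on the other y_j. For i <> i0, m_i / w_0 is already dual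
    to these y_j, and subtracting a multiple of the weight functional makes it vanish on t. *)
Lemma dual_weightP i j :
  log_weight (dual_weight i) (exp_num j) - log_weight (dual_weight i) (exp_den j)
  = (i == j)%:R.
Proof.
have nat1 : (dot p w)%:R - (dot q w)%:R = 1 :> k.
  by rewrite pqw -addn1 natrD addrAC subrr add0r.
rewrite !log_weightE /exp_num /exp_den.
have [ii|ij0] := eqVneq i i0; have [jj|jj0] := eqVneq j i0.
- by rewrite nat1 ii jj eqxx.
- by rewrite ii eq_sym (negPf jj0) !dotMl !dot1 mulnC subrr.
- rewrite jj (negPf ij0) -mulrBl.
  set a := (p i)%:R in nat1 *; set b := (q i)%:R in nat1 *.
  have -> : a - (a - b) * (dot p w)%:R - (b - (a - b) * (dot q w)%:R)
      = (a - b) * (1 - ((dot p w)%:R - (dot q w)%:R)) by ring.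
  by rewrite nat1 subrr mulr0 mul0r.
- rewrite -mulrBl !dotMl !dot1 !mulmnE !mnm1E [i0 == i]eq_sym (negPf ij0).
  rewrite mul0n [j == i]eq_sym [(w j * _)%N]mulnC; case: eqP => [_|_].
    by rewrite mul1n sub0r opprK subrK divff.
  by rewrite mul0n sub0r opprK addNr mul0r.
Qed.

Definition ycoord j : K := reg 'X_[exp_num j] / reg 'X_[exp_den j].

Definition yderiv i z : K := (ycoord i)^-1 * log_derivation (dual_weight i) z.

Lemma ycoord_neq0 j : ycoord j != 0.
Proof. by rewrite mulf_neq0 ?invr_eq0 ?X_neq0. Qed.

Lemma valn_ycoord j : valn w (ycoord j) = (j == i0)%:Z.
Proof.
have Xi0 m : (reg 'X_[m])^-1 != 0 by rewrite invr_eq0.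
rewrite (valnM w (X_neq0 _) (Xi0 _)) (valnV w (X_neq0 _)).
rewrite !(valn_regular w (mpolyX_neq0 _ _)) !wvalX /exp_num /exp_den.
case: eqP => _; first by rewrite pqw -addn1 PoszD addrAC subrr add0r.
by rewrite !dotMl !dot1 mulnC subrr.
Qed.

(** The i-th log derivation sends y_j to delta_ij y_j, whence the factor 1 / y_i in [yderiv]. For i
    <> i0 this factor is a unit of V; for i = i0 it lowers the value by one, which the Euler
    derivation makes up for. *)
Lemma ycoord_local : local_coordinates V ycoord yderiv.
Proof.
split.
- by move=> i; right; rewrite valn_ycoord; case: eqP.
- move=> i; have := @derivation_lincomb k n 'I_1
    (fun _ => log_derivation (dual_weight i)) (fun _ => (ycoord i)^-1)
    (fun _ => log_derivation_derivation _).
  by under eq_fun do rewrite big_ord1.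
- move=> i z Vz; have yi : vge w (- (i == i0)%:Z) (ycoord i)^-1.
    by right; rewrite (valnV w (ycoord_neq0 i)) valn_ycoord.
  rewrite /V -[0](addNr (i == i0)%:Z); apply: (vgeM yi).
  rewrite /dual_weight; case: (i == i0); first exact: vge_euler_derivation.
  exact: vge_log_derivation.
- move=> i j; rewrite /yderiv log_derivation_laurent dual_weightP -/(ycoord j).
  have [<-|ij] := eqVneq i j.
    by rewrite mpolyC1 regular1 mul1r mulVf// ycoord_neq0.
  by rewrite mpolyC0 regular0 mul0r mulr0.
Qed.

Let t_neq0 : ycoord i0 != 0 := ycoord_neq0 i0.
Let valn_t : valn w (ycoord i0) = 1.
Proof. by rewrite valn_ycoord eqxx. Qed.

Definition monomial_divisor : divisor_over k n :=
  @DivisorOver k n (@weighted_blowup k n w)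
    (@weighted_blowup_model k n w w_pos n_gt0)
    V (@weight_ring_in_blowup k n w w_pos n_gt0)
    (weight_ring_dim_one valn_t t_neq0) (ycoord i0)
    (weight_ring_uniformizer valn_t t_neq0) ycoord yderiv ycoord_local.

Local Notation E := monomial_divisor.

Lemma valn_div_val e z : z != 0 -> div_val V (ycoord i0) e z <-> valn w z = e%:Z.
Proof.
move=> z0.
have te : ycoord i0 ^+ e != 0 := expf_neq0 e t_neq0.
have vte : valn w (ycoord i0 ^+ e) = e%:Z.
  by rewrite (valnX w e t_neq0) valn_t mul1r.
split=> [[u [Vu Vui u0] ->]|vz].
  rewrite (valnM w te u0) vte.
  have ui0 : u^-1 != 0 by rewrite invr_eq0.
  have := vge_neq0 ui0 Vui; rewrite (valnV w u0) oppr_ge0 => u_le.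
  have u_ge := vge_neq0 u0 Vu.
  suff -> : valn w u = 0 by rewrite addr0.
  by apply/eqP; rewrite eq_le u_le u_ge.
have ti0 : (ycoord i0 ^+ e)^-1 != 0 by rewrite invr_eq0.
have zt0 : z / ycoord i0 ^+ e != 0 := mulf_neq0 z0 ti0.
have vzt : valn w (z / ycoord i0 ^+ e) = 0.
  by rewrite (valnM w z0 ti0) (valnV w te) vte vz subrr.
exists (z / ycoord i0 ^+ e); last by rewrite mulrC (divfK te).
split; last exact: zt0.
  by right; rewrite vzt.
by right; rewrite (valnV w zt0) vzt.
Qed.

Lemma monomial_divisor_coord_vals : coord_vals E w.
Proof. by move=> i; apply/valn_div_val; rewrite ?coord_neq0 ?valn_coord. Qed.

(** As D_i x_l = y_i^-1 c_il x_l with constants c_il, the Jacobian is the product of all y_i^-1, of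
    det C and of all x_l. These have values -1, 0 and |w|; the constant det C is nonzero because the
    Jacobian is. *)
Lemma monomial_divisor_k : (k_ E).+1 = mdeg w.
Proof.
have J0 := jacobian_neq0 E.
have /(valn_div_val _ J0) kE : div_val V (ycoord i0) (k_ E) (jacobian E).
  exact: (k_P E).
pose C := \matrix_(i < n, l < n) reg (dual_weight i l)%:MP.
have JE : jacobian E = (\prod_i (ycoord i)^-1) * \det C * \prod_l x l.
  have -> : jacobian E = \det (diag_mx (\row_i (ycoord i)^-1) *m C *m
      diag_mx (\row_l x l)).
    congr (\det _); apply/matrixP => i l.
    rewrite mul_mx_diag mul_diag_mx !mxE /=.
    rewrite /yderiv log_derivation_monomial mulrA; congr (_ * reg _%:MP * _).
    rewrite /log_weight (bigD1 l)//= mnm1E eqxx mulr1 big1 ?addr0// => l' l'l.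
    by rewrite mnm1E eq_sym (negPf l'l) mulr0.
  rewrite !det_mulmx !det_diag; congr (_ * _ * _); apply: eq_bigr => i _;
    by rewrite mxE.
have [c cE] : exists c : k, reg c%:MP = \det C.
  have csub : is_subring [set z | exists c : k, reg c%:MP = z].
    split.
    - by exists 1; rewrite mpolyC1 regular1.
    - by move=> _ _ [a <-] [b <-]; exists (a - b); rewrite mpolyCB regularD regularN.
    - by move=> _ _ [a <-] [b <-]; exists (a * b); rewrite mpolyCM regularM.
  by apply: (subring_det csub) => i l; exists (dual_weight i l); rewrite mxE.
have valn_prod (F : 'I_n -> K) : (forall i, F i != 0) ->
    \prod_i F i != 0 /\ valn w (\prod_i F i) = \sum_i valn w (F i).
  move=> F0; elim/big_rec2: _ => [|i z y _ [z0 <-]].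
    by rewrite oner_neq0 valn1.
  by split; [exact: (mulf_neq0 (F0 i) z0)|exact: (valnM w (F0 i) z0)].
have yi0 i : (ycoord i)^-1 != 0 by rewrite invr_eq0 ycoord_neq0.
have [Y0 vY] := valn_prod (fun i => (ycoord i)^-1) yi0.
have [X0 vX] := valn_prod (fun l => x l) (fun l => coord_neq0 k l).
have D0 : \det C != 0.
  by apply: contraNneq J0 => D0; rewrite JE D0 mulr0 mul0r.
have c0 : c != 0 by apply: contraNneq D0 => c0; rewrite -cE c0 mpolyC0 regular0.
have vD : valn w (\det C) = 0.
  have cM0 : c%:MP != 0 :> {mpoly k[n]} by rewrite mpolyC_eq0.
  by rewrite -cE (valn_regular w cM0) wvalC.
move: kE; rewrite JE (valnM w (mulf_neq0 Y0 D0) X0) (valnM w Y0 D0).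
rewrite vY vD vX addr0.
have -> : \sum_i valn w (ycoord i)^-1 = -1.
  rewrite (bigD1 i0)//= (valnV w (ycoord_neq0 _)) valn_ycoord eqxx.
  rewrite big1 ?addr0// => i ii0.
  by rewrite (valnV w (ycoord_neq0 _)) valn_ycoord (negPf ii0).
have -> : \sum_l valn w (x l) = (mdeg w)%:Z.
  rewrite mdegE (big_morph Posz PoszD (erefl _)).
  by apply: eq_bigr => l _; rewrite valn_coord.
lia.
Qed.

Lemma monomial_divisor_center : center E = closed_point (@origin k n).
Proof.
have ev0 f : f.@[@origin k n] = f@_0%MM.
  rewrite mevalE [in RHS](mpolyE f) raddf_sum; apply: eq_bigr => m _ /=.
  rewrite mcoeffZ mcoeffX; congr (_ * _).
  have [->|m0] := eqVneq m 0%MM; first by apply: big1 => i _; rewrite mnm0E.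
  have [i mi] : exists i, m i != 0%N.
    apply/existsP; apply: contraNT m0 => /existsPn/= m0.
    by apply/eqP/mnmP => i; rewrite mnm0E; apply/eqP; rewrite -[_ == _]negbK m0.
  by rewrite (bigD1 i)//= expr0n (negPf mi) mul0r.
apply/seteqP; split=> f; rewrite /center /closed_point /= ev0.
  rewrite weight_ring_nonunits => /vge_regular f1.
  apply/eqP; rewrite mcoeff_eq0; apply/negP => /f1.
  by rewrite dot0.
move=> f0; rewrite weight_ring_nonunits; apply/vge_regular => m mf.
rewrite lez_nat; apply: leq_trans (leq_mdeg_dot m w_pos).
rewrite lt0n mdeg_eq0; apply: contraTneq mf => ->.
by rewrite -mcoeff_eq0 f0.
Qed.

End MonomialDivisor.

(** * Minimal log discrepancies *)

Section Homogeneity.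
Variable n : nat.
Implicit Types m w : 'X_{1..n}.

(** The monomial that computes H at one of the two weights bounds H at the other. *)
Lemma order_funM (H : 'X_{1..n} -> nat) w e : order_fun H -> wpos w ->
  (0 < e)%N -> H (w *+ e)%MM = (H w * e)%N.
Proof.
move=> HO w_pos e_gt0.
have we_pos : wpos (w *+ e)%MM by move=> i; rewrite mulmnE muln_gt0 w_pos.
have [m [mE /(_ _ we_pos)]] := HO w w_pos.
have [m' [m'E /(_ _ w_pos)]] := HO _ we_pos.
rewrite -m'E -mE !dotMr => le1 le2; apply/eqP; rewrite eqn_leq le2.
by rewrite leq_mul2r le1 orbT.
Qed.

Lemma phiM (R : realType) (T : finType) (lam : T -> R)
    (H : T -> 'X_{1..n} -> nat) w e : (forall r, order_fun (H r)) -> wpos w ->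
  (0 < e)%N -> phi lam H (w *+ e)%MM = e%:R * phi lam H w.
Proof.
move=> HO w_pos e_gt0; rewrite /phi mulrBr mdegMn natrM mulrC; congr (_ - _).
rewrite mulr_sumr; apply: eq_bigr => r _.
by rewrite (order_funM (HO r))// natrM; ring.
Qed.

(* The least positive value of [dot p w - dot q w] divides every weight. *)
Lemma primitive_multiple w : (0 < n)%N -> wpos w -> exists w' p q e,
  [/\ (0 < e)%N, w = (w' *+ e)%MM, wpos w' & dot p w' = (dot q w').+1].
Proof.
move=> n_gt0 w_pos.
have exg : exists g, `[< (0 < g)%N /\ exists p q, dot p w = (dot q w + g)%N >].
  exists (w (Ordinal n_gt0)); apply/asboolP; split=> //.
  by exists U_(Ordinal n_gt0)%MM, 0%MM; rewrite dot1 dot0.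
case: (ex_minnP exg) => g /asboolP[g_gt0 [p [q pqE]]] gmin.
have gw i : (w i %/ g * g)%N = w i.
  rewrite divnK//; have [/eqP//|r_gt0] := posnP (w i %% g).
  suff /gmin : `[< (0 < w i %% g)%N /\
      exists p q, dot p w = (dot q w + w i %% g)%N >].
    by rewrite leqNgt ltn_pmod.
  apply/asboolP; split; first exact: r_gt0.
  (* The remainder is w_i - c g with c = w_i %/ g; substitute g = dot p w - dot q w and move the
     negative terms to the other side. *)
  exists (U_(i) + q *+ (w i %/ g))%MM, (p *+ (w i %/ g))%MM.
  rewrite dotDl !dotMl dot1 pqE mulnDl [(g * _)%N]mulnC.
  by rewrite -addnA -divn_eq addnC.
have wE : w = ([multinom (w i %/ g)%N | i < n] *+ g)%MM.
  by apply/mnmP => i; rewrite mulmnE mnmE gw.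
exists [multinom (w i %/ g)%N | i < n], p, q, g; split=> //.
  by move=> i; rewrite mnmE -(ltn_pmul2r g_gt0) mul0n gw.
apply/eqP; rewrite -(eqn_pmul2r g_gt0) mulSn addnC -!dotMr -wE pqE.
by rewrite eqxx.
Qed.

End Homogeneity.

Lemma submodule_gen0 (L : comNzRingType) (A : set L) :
  submodule_gen A set0 = [set 0].
Proof.
apply/seteqP; split=> [z|_ ->]; last by move=> J [[]].
apply; split=> //; split=> // [_ _ -> ->|a _ _ ->]; first exact: addr0.
exact: mulr0.
Qed.

Section LogDiscrepancy.
Variables (k : closedFieldType) (n : nat) (R : realType) (a : Rideal k n R).
Variable M : 'I_(nfactors a) -> set 'X_{1..n}.
Hypothesis aM : forall j,
  factor j = submodule_gen setT [set 'X_[k, m] | m in M j].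
Variable s : seq R.
Hypothesis exponent_s :
  forall j, 0 < @exponent k n R a j -> @exponent k n R a j \in s.

Lemma exponents_nonempty j : M j !=set0.
Proof.
apply: contrapT => M0; apply: (@factor_neq0 _ _ _ a j); rewrite aM.
suff -> : M j = set0 by rewrite image_set0 submodule_gen0.
by apply/seteqP; split=> // m Mm; apply: M0; exists m.
Qed.

(** The order function of the product of all factors with exponent r. *)
Definition grouped_order (r : seq_sub s) (w : 'X_{1..n}) : nat :=
  (\sum_(j | exponent j == ssval r) min_dot (M j) w)%N.

Lemma order_fun_grouped r : order_fun (grouped_order r).
Proof.
apply: order_fun_sum => j; apply: order_fun_min_dot; exact: exponents_nonempty.
Qed.

Lemma ordR_phi (E : divisor_over k n) w : coord_vals E w ->
  (mdeg w)%:R - ordR E a = phi (fun r : seq_sub s => ssval r) grouped_order w.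
Proof.
move=> vx; rewrite /phi; congr (_ - _); rewrite /ordR /grouped_order.
under [RHS]eq_bigr do rewrite natr_sum mulr_sumr big_mkcond.
rewrite exchange_big; apply: eq_bigr => j _ /=.
rewrite aM (ord_monomial (exponents_nonempty j) vx) -big_mkcond /=.
have [e_gt0|] := ltP 0 (exponent j); last first.
  rewrite le_eqVlt ltNge exponent_ge0 orbF => /eqP e0.
  rewrite e0 mul0r big1// => r /eqP <-; by rewrite mul0r.
rewrite (bigD1 (SeqSub (exponent_s e_gt0)))//= big1 ?addr0// => r /andP[/eqP er].
by case/eqP; apply/val_inj.
Qed.

End LogDiscrepancy.

Theorem theorem1p4 (k : closedFieldType) (char_k0 : [pchar k] =i pred0)
    (R : realType) (n : nat) (n_gt0 : (0 < n)%N)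
    (I : set R) (I_fin : finite_set I) (I_ge0 : forall r, I r -> 0 <= r) :
  exists l : nat, (0 < l)%N /\
    forall a : Rideal k n R, monomial a -> exponents_in I a ->
      exists E : divisor_over k n,
        computes_mld E (@origin k n) a /\ (k_ E <= l)%N.
Proof.
have [s0 IE] := (finite_seqP I).1 I_fin.
pose s := [seq r <- s0 | 0 < r].
have s_gt0 (r : seq_sub s) : 0 < ssval r.
  by have := ssvalP r; rewrite mem_filter => /andP[].
have [l lP] := bounded_phi_min n s_gt0.
(* The successor makes the bound visibly positive. *)
exists l.+1; split=> // a /choice[M aM] aI.
have exponent_s j : 0 < @exponent k n R a j -> @exponent k n R a j \in s.
  by move=> e0; rewrite mem_filter e0 /=; have := aI j; rewrite IE.
have HO := order_fun_grouped aM (s := s).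
have [w0 [w0_pos w0l w0P]] := lP (grouped_order M (s := s)) HO.
have [w [p [q [e [e_gt0 wE w_pos pqw]]]]] := primitive_multiple n_gt0 w0_pos.
rewrite wE in w0P w0l; rewrite (phiM _ HO w_pos e_gt0) in w0P.
set ph := phi _ _ in w0P.
(* By homogeneity ph has value e * ph w at the original weight, so a negative sign passes to w.
   Otherwise ph w >= 0, hence ph w <= e * ph w, and minimality passes to w. *)
have wP : ph w < 0 \/ forall u, wpos u -> ph w <= ph u.
  have [phi_ge0|] := leP 0 (ph w); last by left.
  right=> u u_pos; case: w0P => [|/(_ u u_pos)].
    by rewrite ltNge mulr_ge0.
  by apply: le_trans; rewrite ler_peMl// ler1n.
pose E := monomial_divisor char_k0 n_gt0 w_pos pqw.
have kE : (k_ E).+1 = mdeg w := monomial_divisor_k char_k0 n_gt0 w_pos pqw.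
have cE : center E = closed_point (@origin k n).
  exact: monomial_divisor_center.
have EE : log_discrepancy E a = ph w.
  rewrite /log_discrepancy natr1 kE; apply: (ordR_phi aM exponent_s).
  exact: monomial_divisor_coord_vals.
have lower E' : center E' = closed_point (@origin k n) ->
    exists2 u, wpos u & ph u <= log_discrepancy E' a.
  move=> /coord_vals_exist[u u_pos ux]; exists u => //.
  rewrite /ph -(ordR_phi aM exponent_s ux) /log_discrepancy lerD2r.
  by rewrite natr1 ler_nat mdeg_le_k.
exists E; split; last first.
  apply: (@leq_trans (mdeg w)); first by rewrite -kE.
  by rewrite (leq_trans _ (leqW w0l))// mdegMn leq_pmulr.
split=> //; rewrite EE.
have mld_le : (mld (@origin k n) a <= (ph w)%:E)%E.
  by apply: ereal_inf_lbound; exists E => //; rewrite EE.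
case: wP => [ph_lt0|ph_min].
  rewrite ifF//; apply/negbTE; rewrite -ltNge; apply: le_lt_trans mld_le _.
  by rewrite lte_fin.
have mldE : mld (@origin k n) a = (ph w)%:E.
  apply/eqP; rewrite eq_le mld_le; apply: le_ereal_inf_tmp => _ [E' cE' <-].
  have [u u_pos ule] := lower E' cE'; rewrite lee_fin; apply: le_trans ule.
  exact: ph_min.
by rewrite mldE lee_fin; case: ltP.
Qed.
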